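(* Suppose that the map $H:\mathbb{Q}\times\mathbb{P}\to\mathbb{Q}\times\mathbb{P}$, $H(q,p)=(Q,P)=(Q(q,p),P(q,p))$, satisfies the invariance properties: (i) $(f\cdot g)\circ H=f\cdot g$, where $(f\cdot g)(q,p)=f(q)g(p)$; (ii) $\iint_{\mathbb{Q}\times\mathbb{P}}A\circ H=\iint_{\mathbb{Q}\times\mathbb{P}}A$ for every integrable $A$ on $\mathbb{Q}\times\mathbb{P}$; (iii) $\{Q(q,p):p\in\mathbb{P}\}=\mathbb{Q}$ for almost every $q\in\mathbb{Q}$; (iv) $\mathbb{Q}$ is the support of $f$. Suppose also that the operator $\mathcal{T}$, $\mathcal{T}h(q)=\int_{\mathbb{P}}(h\cdot g)\circ H(q,p)\,dp$, is self-adjoint, i.e. $\mathcal{T}^\dagger=\mathcal{T}$. Let $1<\mathfrak{q}<\infty$ and $h\in L^{\mathfrak{q}}(\mathbb{Q})$. Then the sequence $\mathcal{T}^n h$ converges weakly in $L^{\mathfrak{q}}(\mathbb{Q})$ to $f\cdot\dfrac{\int_{\mathbb{Q}}h}{\int_{\mathbb{Q}}f}$, and if $2\le\mathfrak{q}<\infty$ it also converges to this limit strongly (in the norm $\|\cdot\|_{\mathfrak{q}}$).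
   Context: $\mathbb{Q}$ and $\mathbb{P}$ denote two spaces (not the rationals) equipped with $\sigma$-finite reference measures (Lebesgue measure in the Hamiltonian Monte Carlo setting); all integrals without further indication are with respect to these measures and their product on $\mathbb{Q}\times\mathbb{P}$. $f\ge 0$ is a measurable function on $\mathbb{Q}$ with $0<\int_{\mathbb{Q}}f<\infty$; that $\mathbb{Q}$ is its support is understood so that division by $f$ makes sense ($f>0$ almost everywhere). $g>0$ is a probability density on $\mathbb{P}$, $\int_{\mathbb{P}}g=1$. $H$ is measurable and invertible, with measurable inverse $H^{-1}$. For functions $h$ on $\mathbb{Q}$ and $g$ on $\mathbb{P}$, $(h\cdot g)(q,p)=h(q)g(p)$. The operators are $\mathcal{T}h=\int_{\mathbb{P}}(h\cdot g)\circ H\,dp$ and $\mathcal{T}^\dagger h=\int_{\mathbb{P}}(h\cdot g)\circ H^{-1}\,dp$, for integrable $h$ on $\mathbb{Q}$; $\mathcal{T}^\dagger=\mathcal{T}$ means that $\mathcal{T}^\dagger h=\mathcal{T}h$ for all integrable $h$. $\mathcal{T}^n$ is the $n$-th iterate. For $1<\mathfrak{q}<\infty$, $L^{\mathfrak{q}}(\mathbb{Q})$ is the space of functions $h:\mathbb{Q}\to\mathbb{R}$ (supported in the support of $f$) with $\|h\|_{\mathfrak{q}}^{\mathfrak{q}}=\int_{\mathbb{Q}}|h|^{\mathfrak{q}}/f^{\mathfrak{q}-1}=\int_{\mathbb{Q}}|h/f|^{\mathfrak{q}}f<\infty$. With $\mathfrak{p}$ the conjugate exponent ($\mathfrak{p}+\mathfrak{q}=\mathfrak{p}\mathfrak{q}$),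 the duality pairing $L^{\mathfrak{q}}\times L^{\mathfrak{p}}\to\mathbb{R}$ is $\langle a,b\rangle=\int_{\mathbb{Q}}ab/f$; weak convergence $h_n\rightharpoonup h_\infty$ in $L^{\mathfrak{q}}$ means $\langle h_n,b\rangle\to\langle h_\infty,b\rangle$ for all $b\in L^{\mathfrak{p}}$.
   Formalization: Condition (iii) is read modulo null sets: for almost every q and every null set N of P, the set {Q(q,p): p not in N} is Q up to a null set; with literal surjectivity the claim fails, as Q(q,p) may differ from q only for p in a null set, so that T is the identity. *)

(* Defs.v *)
From HB Require Import structures.
From mathcomp Require Import all_boot all_order all_algebra.
From mathcomp Require Import all_classical all_reals all_analysis.
Set Implicit Arguments.
Unset Strict Implicit.
Unset Printing Implicit Defensive.
Import Order.TTheory GRing.Theory Num.Theory.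
Import numFieldNormedType.Exports.
Local Open Scope classical_set_scope.
Local Open Scope ring_scope.

Section Operator.
Context {R : realType} {dQ dP : measure_display}.
Context {Q : measurableType dQ} {P : measurableType dP}.

(* [(h . g)(q, p) = h q * g p] *)
Definition tensor (h : Q -> R) (g : P -> R) (z : Q * P) : R := h z.1 * g z.2.

(* With [G := H] this is T, with [G := H^-1] it is T^dagger.  For integrable
   [h] the integral exists for almost every [q]; at the exceptional [q] the
   real-valued integral takes a junk value, so identities between functions of
   the form [avg_op nu g G h] are to be read almost everywhere. *)
Definition avg_op (nu : {measure set P -> \bar R}) (g : P -> R)
    (G : Q * P -> Q * P) (h : Q -> R) : Q -> R :=
  fun q => \int[nu]_p tensor h g (G (q, p)).

(* [phi : P -> Q] covers [Q] modulo null sets: the values that [phi] takes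
   outside any given null set of arguments exhaust [Q] up to a null set.
   Plain surjectivity is not invariant under changing [phi] on a null set and
   would say nothing about integrals of functions of [phi].  A surjective
   [phi] which maps null sets to null sets (for instance a C^1 map between
   open subsets of R^n, with Lebesgue measure) covers [Q] in this sense. *)
Definition covers (mu : {measure set Q -> \bar R})
    (nu : {measure set P -> \bar R}) (phi : P -> Q) : Prop :=
  forall N : set P, nu.-negligible N -> mu.-negligible (~` (phi @` (~` N))).

End Operator.

Section WeightedLebesgueSpaces.
Context {R : realType} {dQ : measure_display} {Q : measurableType dQ}.
Variables (mu : {measure set Q -> \bar R}) (f : Q -> R).

(* The weight [f] is meant to be positive almost everywhere, so the (zero)
   value of the integrands below where [f] vanishes is immaterial, and every
   function is supported in the support of [f] up to a null set. *)

(* The norm is extended-real valued. *)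
Definition wnorm (r : R) (h : Q -> R) : \bar R :=
  ((\int[mu]_q (`|h q| `^ r / f q `^ (r - 1))%:E) `^ r^-1)%E.

Definition wLspace (r : R) (h : Q -> R) : Prop :=
  measurable_fun setT h /\
  (\int[mu]_q (`|h q| `^ r / f q `^ (r - 1))%:E < +oo)%E.

Definition wpairing (a b : Q -> R) : R := \int[mu]_q (a q * b q / f q).

Definition wweak_cvg (r : R) (u : nat -> Q -> R) (l : Q -> R) : Prop :=
  [/\ forall n, wLspace r (u n),
      wLspace r l &
      forall (s : R) (b : Q -> R), s + r = s * r -> wLspace s b ->
        (fun n => wpairing (u n) b) @ \oo --> wpairing l b].

Definition wstrong_cvg (r : R) (u : nat -> Q -> R) (l : Q -> R) : Prop :=
  [/\ forall n, wLspace r (u n),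
      wLspace r l &
      (fun n => wnorm r (fun q => u n q - l q)) @ \oo --> 0%E].

End WeightedLebesgueSpaces.

(* Main.v *)
Require Import Defs.
From HB Require Import structures.
From mathcomp Require Import all_boot all_order all_algebra.
From mathcomp Require Import all_classical all_reals all_analysis.
From mathcomp Require Import measurable_realfun ring lra.
Set Implicit Arguments.
Unset Strict Implicit.
Unset Printing Implicit Defensive.
Import Order.TTheory GRing.Theory Num.Theory.
Import numFieldNormedType.Exports.
Local Open Scope classical_set_scope.
Local Open Scope ring_scope.

(** Divide by [f].  Write [m] for the finite measure of density [f] with respect
    to [mu], [w] for the probability of density [g] with respect to [nu], and
    [K a q = \int[w]_p a (Q (q, p))].  Since [f . g] is [H]-invariant,
    [T h = f * K (h / f)] almost everywhere, and [h |-> h / f] is an isometry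
    from the weighted space of exponent [r] onto [L^r(m)].  The claim becomes
    that the iterates [K^n a] tend to the [m]-mean of [a].

    Invariance of [mu \x nu] and self-adjointness of [T] say that [K] is
    symmetric in [L^2(m)] ([markov_symmetric]).  Testing the symmetry against
    the constant [1] shows that the random map [Q] preserves [m]
    ([ge0_integral_markov]), and Jensen's inequality then makes [K] a contraction
    of every [L^r(m)] with [1 <= r] ([markov_contraction]).

    Let first [a] be bounded.  The energies [|K^n a|_2^2] decrease to a limit,
    and by symmetry the scalar product of [K^i a] and [K^j a] depends only on
    [i + j]; therefore the even iterates form a Cauchy sequence
    ([iter_markov_dist2]).  A rapidly converging subsequence converges almost
    everywhere to a bounded [psi] with [|K psi|_2 = |psi|_2]
    ([iter_markov_ae_limit]).  The defect [|psi|_2^2 - |K psi|_2^2] is the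
    integral over [q] of the variance of [p |-> psi (Q (q, p))], so this function
    is almost everywhere constant for almost every [q], and as [Q (q, _)] covers
    the space, [psi] itself is constant ([markov_rigidity]).  The argument
    excludes the eigenvalue [-1] of [K] together with the non-constant fixed
    points.  The constant is the mean of [a]; the distance from [K^n a] to it is
    nonincreasing and tends to [0] along a subsequence, hence tends to [0]
    ([iter_markov_cvg2]).

    On uniformly bounded functions [L^2] convergence implies [L^r] convergence
    for all [0 < r], and truncation together with the contraction property
    extends the result to [L^r(m)] for [1 <= r] ([iter_markov_cvg]).  Strong
    convergence gives weak convergence by Hoelder's inequality
    ([pairing_cvg]). *)

(** * Bounded measurable functions on a finite measure space *)

Section BoundedMeasurable.
Context {d : measure_display} {T : measurableType d} {R : realType}.
Implicit Types a b : T -> R.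

(** Bounded everywhere, not only essentially: averages of such functions are then
    honest integrals at every point. *)
Definition bmeas a := measurable_fun setT a /\ exists M, forall x, `|a x| <= M.

Lemma bmeas_cst c : bmeas (cst c).
Proof. by split; [exact: measurable_cst|exists `|c|]. Qed.

Lemma bmeasD a b : bmeas a -> bmeas b -> bmeas (fun x => a x + b x).
Proof.
move=> [ma [A hA]] [mb [B hB]]; split; first exact: measurable_funD.
by exists (A + B) => x; rewrite (le_trans (ler_normD _ _))// lerD.
Qed.

Lemma bmeasM a b : bmeas a -> bmeas b -> bmeas (fun x => a x * b x).
Proof.
move=> [ma [A hA]] [mb [B hB]]; split; first exact: measurable_funM.
by exists (A * B) => x; rewrite normrM ler_pM.
Qed.

Lemma bmeasB a b : bmeas a -> bmeas b -> bmeas (fun x => a x - b x).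
Proof.
move=> [ma [A hA]] [mb [B hB]]; split; first exact: measurable_funB.
by exists (A + B) => x; rewrite (le_trans (ler_normB _ _))// lerD.
Qed.

Lemma bmeasX a n : bmeas a -> bmeas (fun x => a x ^+ n).
Proof.
move=> [ma [A hA]]; split; first exact: measurable_funX.
by exists (A ^+ n) => x; rewrite normrX lerXn2r// nnegrE (le_trans _ (hA x)).
Qed.

Lemma bmeas_norm a : bmeas a -> bmeas (fun x => `|a x|).
Proof.
move=> [ma [A hA]]; split; first exact: measurableT_comp.
by exists A => x; rewrite normr_id.
Qed.

Variable mu : {finite_measure set T -> \bar R}.

Lemma bmeas_integrable a : bmeas a -> mu.-integrable setT (EFin \o a).
Proof.
move=> [ma [A hA]]; apply: measurable_bounded_integrable => //.
  by rewrite ltey_eq fin_num_measure.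
by exists A; split=> [|B AB x _]; [exact: num_real|exact: le_trans (hA x) (ltW AB)].
Qed.

Lemma bmeas_RintegralD a b : bmeas a -> bmeas b ->
  \int[mu]_x (a x + b x) = \int[mu]_x a x + \int[mu]_x b x.
Proof. by move=> ? ?; rewrite RintegralD//; exact: bmeas_integrable. Qed.

Lemma bmeas_RintegralB a b : bmeas a -> bmeas b ->
  \int[mu]_x (a x - b x) = \int[mu]_x a x - \int[mu]_x b x.
Proof. by move=> ? ?; rewrite RintegralB//; exact: bmeas_integrable. Qed.

Lemma bmeas_RintegralZl c a : bmeas a ->
  \int[mu]_x (c * a x) = c * \int[mu]_x a x.
Proof. by move=> ?; rewrite RintegralZl//; exact: bmeas_integrable. Qed.

Lemma bmeas_le_Rintegral a b : bmeas a -> bmeas b -> (forall x, a x <= b x) ->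
  \int[mu]_x a x <= \int[mu]_x b x.
Proof. by move=> ? ? ab; apply: le_Rintegral => //; exact: bmeas_integrable. Qed.

Lemma bmeas_le_normr_Rintegral a : bmeas a ->
  `|\int[mu]_x a x| <= \int[mu]_x `|a x|.
Proof. by move=> ?; apply: le_normr_Rintegral => //; exact: bmeas_integrable. Qed.

Lemma bmeas_EFin_Rintegral a : bmeas a ->
  (\int[mu]_x a x)%:E = (\int[mu]_x (a x)%:E)%E.
Proof.
move=> ba; rewrite /Rintegral fineK//.
by apply: integrable_fin_num => //; exact: bmeas_integrable.
Qed.

Lemma bmeas_Rintegral_eq0 a : bmeas a -> (forall x, 0 <= a x) ->
  \int[mu]_x a x = 0 -> {ae mu, forall x, a x = 0}.
Proof.
move=> ba a0 ia.
have : (\int[mu]_x `|(a x)%:E| = 0)%E.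
  under eq_integral do rewrite gee0_abs ?lee_fin//.
  by rewrite -bmeas_EFin_Rintegral// ia.
move/ae_eq_integral_abs => /(_ measurableT).
have mEa : measurable_fun setT (EFin \o a).
  by apply/measurable_EFinP; case: ba.
by move=> /(_ mEa); apply: filterS => x /(_ I) [].
Qed.

Lemma bmeas_bounded_convergence (a_ : nat -> T -> R) a M :
  (forall n, measurable_fun setT (a_ n)) -> (forall n x, `|a_ n x| <= M) ->
  bmeas a -> {ae mu, forall x, a_ ^~ x @ \oo --> a x} ->
  (fun n => \int[mu]_x `|a_ n x - a x|) @ \oo --> (0 : R).
Proof.
move=> ma bM ba aa; have [ma' _] := ba.
have bmd n : bmeas (fun x => `|a_ n x - a x|).
  by apply/bmeas_norm/bmeasB => //; split; [|exists M].
have cM : mu.-integrable setT (EFin \o cst M).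
  exact/bmeas_integrable/bmeas_cst.
have [|||_ + _] := @dominated_convergence _ _ _ mu setT measurableT
  (fun n => EFin \o a_ n) (EFin \o a) (EFin \o cst M)
  (fun n => (measurable_EFinP _ _).2 (ma n)) ((measurable_EFinP _ _).2 ma').
- by apply: filterS aa => x ax _; apply: cvg_EFin => //; exact: nearW.
- by [].
- by apply: aeW => x n _ /=; rewrite lee_fin.
move=> /fine_cvg; apply: cvg_trans; apply: near_eq_cvg; apply: nearW => n /=.
by rewrite /Rintegral; congr fine; apply: eq_integral.
Qed.

End BoundedMeasurable.

Lemma cvg_subseq_ge (X : topologicalType) (u : nat -> X) (l : X) (s : nat -> nat) :
  (forall j, (j <= s j)%N) -> u @ \oo --> l -> (u \o s) @ \oo --> l.
Proof.
move=> js; apply: cvg_comp; apply/cvgnyPge => A; near=> j.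
apply: leq_trans (js j); near: j; exact: nbhs_infty_ge.
Unshelve. all: by end_near. Qed.

Section BoundedMeasurableLimits.
Context {d : measure_display} {T : measurableType d} {R : realType}.
Variable mu : {finite_measure set T -> \bar R}.
Variables (b_ : nat -> T -> R) (b : T -> R) (M : R).
Hypotheses (mb_ : forall n, measurable_fun setT (b_ n))
  (bM : forall n x, `|b_ n x| <= M) (bb : bmeas b).
Hypothesis cvg1 : (fun n => \int[mu]_x `|b_ n x - b x|) @ \oo --> (0 : R).

Let bb_ n : bmeas (b_ n). Proof. by split=> //; exists M. Qed.

Lemma bmeas_Rintegral_cvg :
  (fun n => \int[mu]_x b_ n x) @ \oo --> \int[mu]_x b x.
Proof.
apply/cvgrPdist_le => /= e e0; move/cvgr0Pnorm_le : cvg1 => /(_ _ e0).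
apply: filterS => n; apply: le_trans; rewrite distrC -bmeas_RintegralB//.
rewrite [leRHS]ger0_norm; last by apply: Rintegral_ge0.
by apply: bmeas_le_normr_Rintegral; exact: bmeasB.
Qed.

(** [|x ^+ 2 - y ^+ 2| <= (M + M') * |x - y|] for [x], [y] bounded by [M], [M']. *)
Lemma bmeas_Rintegral_sqr_cvg :
  (fun n => \int[mu]_x (b_ n x ^+ 2)) @ \oo --> \int[mu]_x (b x ^+ 2).
Proof.
have [_ [M' bM']] := bb.
have : (fun n => (M + M') * \int[mu]_x `|b_ n x - b x|) @ \oo --> (0 : R).
  by rewrite -(mulr0 (M + M')); apply: cvgMr.
move=> h; apply/cvgrPdist_le => /= e e0; move/cvgr0Pnorm_le : h => /(_ _ e0).
apply: filterS => n; apply: le_trans; rewrite distrC -bmeas_RintegralB; [|exact: bmeasX..].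
apply: le_trans (ler_norm _).
have bD : bmeas (fun x => `|b_ n x - b x|) by exact/bmeas_norm/bmeasB.
rewrite -bmeas_RintegralZl//.
apply: le_trans (bmeas_le_normr_Rintegral _ _) _; first by apply: bmeasB; exact: bmeasX.
apply: bmeas_le_Rintegral.
- by apply/bmeas_norm/bmeasB; exact: bmeasX.
- exact: (bmeasM (bmeas_cst (M + M'))).
- move=> x; rewrite subr_sqr normrM mulrC ler_wpM2r//.
  by rewrite (le_trans (ler_normD _ _))// lerD.
Qed.

End BoundedMeasurableLimits.

(** The completeness of [L^2] in the case needed: the increments are summable in
    [L^1], so that their series converges absolutely almost everywhere.  Clipping
    the upper limit at [M] makes the limit bounded and measurable everywhere. *)
Lemma fast_cauchy_ae_limit {R : realType} {d : measure_display}
    {T : measurableType d} (mu : {finite_measure set T -> \bar R})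
    (x_ : nat -> T -> R) (M : R) :
  (forall n, measurable_fun setT (x_ n)) -> (forall n t, `|x_ n t| <= M) ->
  (forall n, \int[mu]_t (x_ n.+1 t - x_ n t) ^+ 2 <= (2 ^ n.+1)%:R^-1 ^+ 2) ->
  exists psi, bmeas psi /\ {ae mu, forall t, x_ ^~ t @ \oo --> psi t}.
Proof.
move=> mx xM xfast.
pose e n : R := (2 ^ n.+1)%:R^-1.
have e_gt0 n : 0 < e n by rewrite invr_gt0 ltr0n expn_gt0.
pose dlt n t : R := `|x_ n.+1 t - x_ n t|.
have bx n : bmeas (x_ n) by split=> //; exists M.
have bd n : bmeas (fun t => x_ n.+1 t - x_ n t) by exact: bmeasB.
have bdlt n : bmeas (dlt n) by exact: bmeas_norm.
set C := 1 + fine (mu setT).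
(* [t <= t ^+ 2 / e + e] trades the [L^2] bound for an [L^1] bound. *)
have int_dlt n : \int[mu]_t dlt n t <= e n * C.
  have b2 := bmeasM (bmeas_cst (e n)^-1) (bmeasX 2 (bd n)).
  have be := @bmeas_cst _ T R (e n).
  apply: (@le_trans _ _ (\int[mu]_t ((e n)^-1 * (x_ n.+1 t - x_ n t) ^+ 2 + e n))).
    apply: bmeas_le_Rintegral => //; first exact: bmeasD.
    move=> t; rewrite -(real_normK (num_real (x_ n.+1 t - x_ n t))) -/(dlt n t).
    have d0 : 0 <= dlt n t by exact: normr_ge0.
    have [dle|/ltW ed] := leP (dlt n t) (e n).
      by rewrite (le_trans dle)// lerDr mulr_ge0 ?sqr_ge0// invr_ge0 ltW.
    apply: (@le_trans _ _ ((e n)^-1 * dlt n t ^+ 2)); last by rewrite lerDl ltW.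
    by rewrite mulrC ler_pdivlMr// expr2 ler_wpM2l.
  rewrite bmeas_RintegralD// bmeas_RintegralZl; last exact: bmeasX.
  rewrite Rintegral_cst// /C mulrDr mulr1 lerD2r.
  by rewrite mulrC ler_pdivrMr// -expr2 xfast.
have mEdlt n : measurable_fun setT (fun t => (dlt n t)%:E).
  by apply/measurable_EFinP; have [] := bdlt n.
have int_sum : (\int[mu]_t \sum_(n <oo) (dlt n t)%:E < +oo)%E.
  rewrite integral_nneseries//; last by move=> n t _; rewrite lee_fin normr_ge0.
  apply: (@le_lt_trans _ _ (\sum_(n <oo) (C / (2 ^ (n + 1))%:R)%:E)%E).
    apply: lee_nneseries => [n _ _|n _].
      by apply: integral_ge0 => t _; rewrite lee_fin normr_ge0.
    by rewrite -bmeas_EFin_Rintegral// lee_fin addn1 mulrC.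
  have := @cvg_geometric_eseries_half R C 0.
  by move=> /cvg_lim -> //; rewrite ltry.
have ae_fin : {ae mu, forall t, (\sum_(n <oo) (dlt n t)%:E)%E \is a fin_num}.
  have mS : measurable_fun setT (fun t => \sum_(n <oo) (dlt n t)%:E)%E.
    apply: (@ge0_emeasurable_sum _ _ R setT (fun n t => (dlt n t)%:E) xpredT) => // n t _ _.
    by rewrite lee_fin normr_ge0.
  have : mu.-integrable setT (fun t => \sum_(n <oo) (dlt n t)%:E)%E.
    apply/integrableP; split => //; apply: le_lt_trans int_sum.
    rewrite le_eqVlt; apply/orP; left; apply/eqP; apply: eq_integral => t _.
    by rewrite gee0_abs//; apply: nneseries_ge0 => n _ _; rewrite lee_fin normr_ge0.
  by move=> /(integrable_ae measurableT); apply: filterS => t /(_ I).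
have ae_cvg : {ae mu, forall t, cvgn (x_ ^~ t)}.
  apply: filterS ae_fin => t finS.
  have : cvgn (series (fun n => x_ n.+1 t - x_ n t)).
    apply: normed_cvg; apply: nondecreasing_is_cvgn.
      by apply: nondecreasing_series => n _ _; exact: normr_ge0.
    exists (fine (\sum_(n <oo) (dlt n t)%:E)) => _ [n _ <-].
    rewrite -lee_fin fineK// /series/= -sumEFin.
    by apply: nneseries_lim_ge => k _ _; rewrite lee_fin normr_ge0.
  have -> : (x_ ^~ t) = (fun n => x_ 0%N t +
      series (fun n => x_ n.+1 t - x_ n t) n).
    by apply/funext => n; exact: (eq_sum_telescope (x_ ^~ t)).
  by apply: is_cvgD; exact: is_cvg_cst.
pose lsup t : R := limn_sup (x_ ^~ t).
have bnd t : bounded_fun (x_ ^~ t).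
  by exists M; split=> [|B MB n _]; [exact: num_real|exact: le_trans (xM n t) (ltW MB)].
exists (fun t => Num.max (- M) (Num.min M (lsup t))); split.
  split.
    apply: measurable_maxr; first exact: measurable_cst.
    apply: measurable_minr; first exact: measurable_cst.
    apply: measurable_fun_limn_sup => // t _.
    - exact: bounded_fun_has_ubound.
    - exact: bounded_fun_has_lbound.
  exists `|M| => t.
  have M0 : 0 <= M by exact: le_trans (xM 0%N t).
  by rewrite (ger0_norm M0) ler_norml le_max lexx/= ge_max ge_min lexx/= andbT ge0_cp.
apply: filterS ae_cvg => t xt.
have -> : Num.max (- M) (Num.min M (lsup t)) = limn (x_ ^~ t); last by [].
have /cvg_lim : sups (x_ ^~ t) @ \oo --> limn (x_ ^~ t) by exact: cvg_sups.
rewrite /lsup /limn_sup => -> //.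
have lM : limn (x_ ^~ t) <= M.
  by apply: limr_le => //; apply: nearW => n; exact: le_trans (ler_norm _) (xM n t).
have Ml : - M <= limn (x_ ^~ t).
  by apply: limr_ge => //; apply: nearW => n; have := xM n t; rewrite ler_norml => /andP[].
by rewrite (min_idPr lM) (max_idPr Ml).
Qed.

(** * Absolute moments *)

Lemma cvge0P {R : realType} (u : nat -> \bar R) : (forall n, 0 <= u n)%E ->
  (u @ \oo --> 0%E) <->
  (forall e : R, 0 < e -> \forall n \near \oo, (u n <= e%:E)%E).
Proof.
move=> u0; split=> [/fine_cvgP[ufin /cvgr0Pnorm_le ucvg] e e0|ule].
  apply: filterS2 ufin (ucvg _ e0) => n /fineK <- /=; rewrite lee_fin.
  exact: le_trans (ler_norm _).
have ufin : \forall n \near \oo, u n \is a fin_num.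
  by apply: filterS (ule 1 ltr01) => n un; rewrite ge0_fin_numE// (le_lt_trans un)// ltry.
apply/fine_cvgP; split => //; apply/cvgr0Pnorm_le => e e0.
apply: filterS2 ufin (ule _ e0) => n ufn; rewrite -{1}(fineK ufn) lee_fin /=.
by rewrite ger0_norm// fine_ge0.
Qed.

Section AbsoluteMoments.
Context {d : measure_display} {T : measurableType d} {R : realType}.
Implicit Types (a b : T -> R) (r : R).

Definition abs_moment (mu : {measure set T -> \bar R}) r a : \bar R :=
  (\int[mu]_x (`|a x| `^ r)%:E)%E.

Lemma measurable_norm_powR r a : measurable_fun setT a ->
  measurable_fun setT (fun x => (`|a x| `^ r)%:E).
Proof.
move=> ma; apply/measurable_EFinP.
apply: (measurableT_comp (measurable_powR r)).
exact: measurableT_comp.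
Qed.

Lemma abs_moment_ge0 mu r a : (0 <= abs_moment mu r a)%E.
Proof. by apply: integral_ge0 => x _; rewrite lee_fin powR_ge0. Qed.

Lemma abs_moment_Lnorm mu r a : 0 < r ->
  abs_moment mu r a = ('N[mu]_r%:E[EFin \o a] `^ r)%E.
Proof.
by move=> r0; rewrite poweR_Lnorm ?gt_eqF//; apply: eq_integral => x _ /=.
Qed.

Variable mu : {finite_measure set T -> \bar R}.

(** [|x| <= 1 + |x| `^ r], and constants are integrable for a finite measure. *)
Lemma abs_moment_integrable r a : 1 <= r -> measurable_fun setT a ->
  (abs_moment mu r a < +oo)%E -> mu.-integrable setT (EFin \o a).
Proof.
move=> r1 ma ar; have mar := measurable_norm_powR r ma.
have ipow : mu.-integrable setT (fun x => (`|a x| `^ r)%:E).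
  apply/integrableP; split=> //.
  by under eq_integral do rewrite gee0_abs ?lee_fin ?powR_ge0//.
have i1 : mu.-integrable setT (EFin \o cst 1) := bmeas_integrable mu (bmeas_cst 1).
apply: (le_integrable measurableT _ _ (integrableD measurableT i1 ipow)).
  exact/measurable_EFinP.
move=> x _ /=; rewrite lee_fin (ger0_norm (addr_ge0 ler01 (powR_ge0 _ _))).
have [a1|/ltW a1] := leP `|a x| 1.
  by rewrite (le_trans a1)// lerDl powR_ge0.
by rewrite (le_trans (le1r_powR a1 r1))// lerDr.
Qed.

Lemma abs_moment_cst r c :
  abs_moment mu r (cst c) = (`|c| `^ r * fine (mu setT))%:E.
Proof.
rewrite EFinM fineK ?fin_num_measure//.
exact: (integral_cst mu measurableT (`|c| `^ r)%:E).
Qed.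

Lemma abs_moment_bmeas r a : 0 <= r -> bmeas a -> (abs_moment mu r a < +oo)%E.
Proof.
move=> r0 [ma [A aA]].
have ba : bmeas (fun x => `|a x| `^ r).
  split; first exact/measurable_EFinP/measurable_norm_powR.
  exists (A `^ r) => x; rewrite ger0_norm ?powR_ge0// ge0_ler_powR// nnegrE//.
  exact: le_trans (normr_ge0 _) (aA x).
by rewrite /abs_moment -bmeas_EFin_Rintegral// ltry.
Qed.

(** A quasi-triangle inequality, from [|x + y| <= 2 * max |x| |y|]; its constant
    is harmless in the limit arguments below. *)
Lemma abs_momentD_le r a b : 0 < r -> measurable_fun setT a -> measurable_fun setT b ->
  (abs_moment mu r (fun x => a x + b x)%R <=
    (2 `^ r)%:E * (abs_moment mu r a + abs_moment mu r b))%E.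
Proof.
move=> r0 ma mb; have ma' := measurable_norm_powR r ma.
have mb' := measurable_norm_powR r mb.
rewrite /abs_moment -ge0_integralD//; try by move=> x _; rewrite lee_fin powR_ge0.
rewrite -ge0_integralZl//; last 2 first.
- exact: emeasurable_funD.
- by move=> x _; rewrite adde_ge0// lee_fin powR_ge0.
apply: ge0_le_integral => //.
- by apply: measurable_norm_powR; exact: measurable_funD.
- by apply: measurable_funeM; exact: emeasurable_funD.
move=> x _; rewrite -EFinD -EFinM lee_fin.
apply: (@le_trans _ _ ((2 * Num.max `|a x| `|b x|) `^ r)).
  apply: ge0_ler_powR; rewrite ?nnegrE ?(ltW r0) ?mulr_ge0 ?le_max ?normr_ge0//.
  rewrite (le_trans (ler_normD _ _))// mulr_natl mulr2n.
  by rewrite lerD// le_max lexx ?orbT.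
rewrite powRM// ?le_max ?normr_ge0// ler_wpM2l ?powR_ge0//.
by have [_|_] := leP `|a x| `|b x|; rewrite ?lerDr ?lerDl powR_ge0.
Qed.

End AbsoluteMoments.

(** Hoelder's inequality against the constant function [1], which has norm [1]
    for every exponent. *)
Lemma jensen_powR {R : realType} {d : measure_display} {T : measurableType d}
    (w : probability T R) (r : R) (X : T -> R) :
  1 <= r -> w.-integrable setT (EFin \o X) ->
  ((`|\int[w]_x X x| `^ r)%:E <= abs_moment w r X)%E.
Proof.
move=> r1 iX; have r0 : 0 < r := lt_le_trans ltr01 r1.
have mX : measurable_fun setT X by apply/measurable_EFinP; exact: measurable_int iX.
have mean_le : ((`|\int[w]_x X x|)%:E <= \int[w]_x `|(X x)%:E|)%E.
  by rewrite EFin_normr_Rintegral//; exact: le_abse_integral (measurable_int _ iX).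
move: r1; rewrite le_eqVlt => /predU1P[<-|r1].
  rewrite powRr1// (le_trans mean_le)//.
  by rewrite /abs_moment; under [leRHS]eq_integral do rewrite powRr1//.
rewrite abs_moment_Lnorm// -poweR_EFin.
apply: gt0_ler_poweR; [exact: ltW| | |].
- by rewrite in_itv/= leey lee_fin andbT.
- by rewrite in_itv/= leey Lnorm_ge0.
apply: (le_trans mean_le).
have s0 : 0 < (1 - r^-1)^-1 by rewrite invr_gt0 subr_gt0 invf_lt1.
have := @hoelder _ _ _ w X (cst 1) r (1 - r^-1)^-1 mX (measurable_cst _) r0 s0.
rewrite invrK addrC subrK => /(_ erefl).
rewrite Lnorm1 (_ : EFin \o (cst 1)%R = cst 1%E)// Lnorm_cst1.
rewrite [X in (X `^ _)%E]probability_setT poweR1r mule1; apply: le_trans.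
by under [leRHS]eq_integral do rewrite /= mulr1.
Qed.

Section Truncation.
Context {d : measure_display} {T : measurableType d} {R : realType}.
Variable mu : {finite_measure set T -> \bar R}.
Implicit Types (a : T -> R) (r : R).

Definition truncate k a x : R := Num.max (- k%:R) (Num.min k%:R (a x)).

Lemma bmeas_truncate k a : measurable_fun setT a -> bmeas (truncate k a).
Proof.
move=> ma; split.
  apply: measurable_maxr; first exact: measurable_cst.
  by apply: measurable_minr => //; exact: measurable_cst.
exists k%:R => x; rewrite ler_norml le_max lexx/= ge_max ge_min lexx/= andbT.
by rewrite (@le_trans _ _ 0)// oppr_le0.
Qed.

Lemma truncate_id k a x : `|a x| <= k%:R -> truncate k a x = a x.
Proof.
by rewrite ler_norml => /andP[h1 h2]; rewrite /truncate (min_idPr h2) (max_idPr h1).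
Qed.

Lemma truncate_dist_le k a x : `|a x - truncate k a x| <= `|a x|.
Proof.
have k0 : 0 <= k%:R :> R by [].
rewrite /truncate; have [ka|ka] := leP k%:R (a x).
  rewrite (max_idPr _); last by rewrite (le_trans _ k0)// oppr_le0.
  by rewrite !ger0_norm ?subr_ge0 ?gerBl// (le_trans k0).
have [ka'|ka'] := leP (- k%:R) (a x); first by rewrite subrr normr0.
have a0 : a x <= 0 by rewrite (le_trans (ltW ka'))// oppr_le0.
by rewrite !ler0_norm// ?opprB ?opprK; lra.
Qed.

(** Dominated convergence: at each point the truncation is eventually exact, and
    the difference is dominated by the function itself. *)
Lemma truncate_cvg r a : 0 < r -> measurable_fun setT a ->
  (abs_moment mu r a < +oo)%E ->
  (fun k => abs_moment mu r (fun x => a x - truncate k a x)) @ \oo --> 0%E.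
Proof.
move=> r0 ma ar.
have mt k : measurable_fun setT (fun x => a x - truncate k a x).
  by apply: measurable_funB => //; case: (bmeas_truncate k ma).
have mf k := measurable_norm_powR r (mt k).
have ig : mu.-integrable setT (fun x => (`|a x| `^ r)%:E).
  apply/integrableP; split; first exact: measurable_norm_powR.
  by under eq_integral do rewrite gee0_abs ?lee_fin ?powR_ge0//.
have [||_ _] := dominated_convergence measurableT mf (measurable_cst 0%E) _ ig.
- apply: aeW => x _; apply: cvg_near_cst; near=> k.
  rewrite truncate_id ?subrr ?normr0 ?powR0 ?gt_eqF//.
  by near: k; exact: nbhs_infty_ger.
- apply: aeW => x k _; rewrite gee0_abs ?lee_fin ?powR_ge0//.
  apply: ge0_ler_powR; rewrite ?nnegrE//; first exact: ltW.
  exact: truncate_dist_le.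
by rewrite integral0.
Unshelve. all: by end_near. Qed.

End Truncation.

Section Pairing.
Context {d : measure_display} {T : measurableType d} {R : realType}.
Variable mu : {finite_measure set T -> \bar R}.
Implicit Types (a b : T -> R) (r s : R).

Lemma Lnorm_abs_moment r a : 0 < r ->
  'N[mu]_r%:E[EFin \o a]%E = (abs_moment mu r a `^ r^-1)%E.
Proof.
by move=> r0; rewrite abs_moment_Lnorm// -poweRrM mulfV ?gt_eqF// poweRe1// Lnorm_ge0.
Qed.

Lemma abs_moment_mul_integrable r s a b : 0 < r -> 0 < s -> r^-1 + s^-1 = 1 ->
  measurable_fun setT a -> measurable_fun setT b ->
  (abs_moment mu r a < +oo)%E -> (abs_moment mu s b < +oo)%E ->
  mu.-integrable setT (EFin \o (fun x => a x * b x)).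
Proof.
move=> r0 s0 rs ma mb ar bs; apply/integrableP; split.
  by apply/measurable_EFinP; exact: measurable_funM.
have := hoelder mu ma mb r0 s0 rs; rewrite Lnorm1 => /le_lt_trans; apply.
by rewrite !Lnorm_abs_moment// lte_mul_pinfty ?poweR_ge0// ?poweR_lty//
  fin_numElt (lt_le_trans _ (poweR_ge0 _ _))// poweR_lty.
Qed.

(** The step from strong to weak convergence: Hoelder's inequality applied to the
    differences [x_ n - x] and to the fixed [b]. *)
Lemma pairing_cvg r s (x_ : nat -> T -> R) x b :
  0 < r -> 0 < s -> r^-1 + s^-1 = 1 ->
  (forall n, measurable_fun setT (x_ n)) -> measurable_fun setT x ->
  measurable_fun setT b ->
  (forall n, abs_moment mu r (x_ n) < +oo)%E -> (abs_moment mu r x < +oo)%E ->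
  (abs_moment mu s b < +oo)%E ->
  (fun n => abs_moment mu r (fun t => x_ n t - x t)%R) @ \oo --> 0%E ->
  (fun n => \int[mu]_t (x_ n t * b t)) @ \oo --> \int[mu]_t (x t * b t).
Proof.
move=> r0 s0 rs mx_ mx mb x_r xr bs cvg_x.
have ixb_ n := abs_moment_mul_integrable r0 s0 rs (mx_ n) mb (x_r n) bs.
have ixb := abs_moment_mul_integrable r0 s0 rs mx mb xr bs.
set K := fine (abs_moment mu s b `^ s^-1)%E.
have KE : (abs_moment mu s b `^ s^-1)%E = K%:E.
  rewrite fineK// fin_numElt (lt_le_trans _ (poweR_ge0 _ _))//= poweR_lty//.
have K0 : 0 <= K by rewrite fine_ge0// poweR_ge0.
apply/cvgrPdist_le => /= e e0.
(* [K + 1] in place of [K], which may vanish. *)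
pose e1 := (e / (K + 1)) `^ r.
have eK0 : 0 < e / (K + 1) by rewrite divr_gt0// ltr_wpDl.
have e10 : 0 < e1 by rewrite powR_gt0.
have /cvge0P - /(_ (fun n => abs_moment_ge0 _ _ _) _ e10) := cvg_x.
apply: filterS => n xn.
have md : measurable_fun setT (fun t => x_ n t - x t) by exact: measurable_funB.
rewrite distrC -RintegralB// -lee_fin EFin_normr_Rintegral//; last first.
  exact: (integrableB measurableT (ixb_ n) ixb).
have -> : e = e1 `^ r^-1 * (K + 1).
  by rewrite /e1 -powRrM mulfV ?gt_eqF// powRr1 ?(ltW eK0)// divfK// gt_eqF// ltr_wpDl.
have E : (fun t => (x_ n t * b t - x t * b t)%:E) =
    EFin \o ((fun t => x_ n t - x t) \* b).
  by apply/funext => t /=; rewrite mulrBl.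
rewrite E; apply: (@le_trans _ _ 'N[mu]_1[EFin \o ((fun t => x_ n t - x t) \* b)%R]%E).
  rewrite Lnorm1; apply: le_abse_integral => //.
  by apply/measurable_EFinP; exact: measurable_funM.
apply: (le_trans (hoelder mu md mb r0 s0 rs)).
rewrite (Lnorm_abs_moment _ r0) (Lnorm_abs_moment _ s0) KE EFinM; apply: lee_pmul.
- exact: poweR_ge0.
- by rewrite lee_fin.
- rewrite -poweR_EFin; apply: gt0_ler_poweR.
  + by rewrite invr_ge0 ltW.
  + by rewrite in_itv/= leey abs_moment_ge0.
  + by rewrite in_itv/= leey lee_fin ltW.
  + exact: xn.
- by rewrite lee_fin lerDl.
Qed.

End Pairing.

(** * The Markov operator of a random map *)

(** No integrability is assumed, so iterates of an averaging operator are
    measurable everywhere, including at points where the integral is junk. *)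
Lemma measurable_Rintegral_snd {R : realType} {d1 d2 : measure_display}
    {T1 : measurableType d1} {T2 : measurableType d2}
    (mu : {sigma_finite_measure set T2 -> \bar R}) (F : T1 * T2 -> R) :
  measurable_fun setT F ->
  measurable_fun setT (fun x => \int[mu]_y F (x, y)).
Proof.
move=> mF; apply: (measurableT_comp (fine_measurable measurableT)).
have mEF : measurable_fun setT (EFin \o F) by exact/measurable_EFinP.
have -> : (fun x => \int[mu]_y (F (x, y))%:E)%E =
    (fubini_F mu (EFin \o F)^\+ \- fubini_F mu (EFin \o F)^\-)%E.
  apply/funext => x; rewrite integralE; congr (_ - _)%E;
    by apply: eq_integral => y _; rewrite ?funeposE ?funenegE.
apply: emeasurable_funB.
- by apply: measurable_fun_fubini_tonelli_F => //; exact: measurable_funepos.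
- by apply: measurable_fun_fubini_tonelli_F => //; exact: measurable_funeneg.
Qed.

Lemma Rintegral_probability_cst {R : realType} {d : measure_display}
    {T : measurableType d} (w : probability T R) (c : R) :
  \int[w]_x (cst c x) = c.
Proof. by rewrite Rintegral_cst//= [X in fine X]probability_setT mulr1. Qed.

Section MarkovOperator.
Context {R : realType} {dQ dP : measure_display}.
Context {Q : measurableType dQ} {P : measurableType dP}.
Variables (m : {finite_measure set Q -> \bar R}) (w : probability P R).
Variable Phi : Q * P -> Q.
Implicit Types a b : Q -> R.

Definition markov_op (a : Q -> R) : Q -> R := fun q => \int[w]_p a (Phi (q, p)).

Hypothesis mPhi : measurable_fun setT Phi.

Lemma measurable_markov a : measurable_fun setT a ->
  measurable_fun setT (markov_op a).
Proof.
by move=> ma; apply: (measurable_Rintegral_snd w (F := a \o Phi));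
  exact: measurableT_comp.
Qed.

Lemma measurable_iter_markov a n : measurable_fun setT a ->
  measurable_fun setT (iter n markov_op a).
Proof. by move=> ma; elim: n => //= n; exact: measurable_markov. Qed.

Lemma bmeas_section a q : bmeas a -> bmeas (fun p => a (Phi (q, p))).
Proof.
move=> [ma [A hA]]; split; last by exists A.
by apply: (measurableT_comp ma); exact: (measurable_fun_pair2 q mPhi).
Qed.

Lemma markov_le a A : measurable_fun setT a -> (forall q, `|a q| <= A) ->
  forall q, `|markov_op a q| <= A.
Proof.
move=> ma hA q; have ba : bmeas a by split; last by exists A.
have bs := bmeas_section q ba.
apply: (le_trans (bmeas_le_normr_Rintegral _ bs)).
apply: (@le_trans _ _ (\int[w]_p cst A p)).
  by apply: bmeas_le_Rintegral => //; [exact: bmeas_norm|exact: bmeas_cst].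
by rewrite Rintegral_probability_cst.
Qed.

Lemma bmeas_markov a : bmeas a -> bmeas (markov_op a).
Proof.
move=> [ma [A hA]]; split; first exact: measurable_markov.
by exists A; exact: markov_le.
Qed.

Lemma bmeas_iter_markov a n : bmeas a -> bmeas (iter n markov_op a).
Proof. by move=> ba; elim: n => //= n; exact: bmeas_markov. Qed.

Lemma iter_markov_le a A n : measurable_fun setT a -> (forall q, `|a q| <= A) ->
  forall q, `|iter n markov_op a q| <= A.
Proof.
move=> ma hA; elim: n => //= n; apply: markov_le.
exact: measurable_iter_markov.
Qed.

Lemma markov_cst c : markov_op (cst c) = cst c.
Proof.
by apply/funext => q; exact: Rintegral_probability_cst.
Qed.

Lemma markovB a b q : bmeas a -> bmeas b ->
  markov_op (fun x => a x - b x) q = markov_op a q - markov_op b q.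
Proof. by move=> ba bb; rewrite /markov_op bmeas_RintegralB//; exact: bmeas_section. Qed.

Hypothesis sym : forall a b, bmeas a -> bmeas b ->
  \int[m]_q (markov_op a q * b q) = \int[m]_q (a q * markov_op b q).

(** Symmetry tested against the constant [1], which the operator fixes. *)
Lemma Rintegral_markov a : bmeas a -> \int[m]_q markov_op a q = \int[m]_q a q.
Proof.
move=> ba; have := sym ba (bmeas_cst 1); rewrite markov_cst.
by under eq_Rintegral do rewrite mulr1; under [RHS]eq_Rintegral do rewrite mulr1.
Qed.

Lemma Rintegral_iter_markov a n : bmeas a ->
  \int[m]_q iter n markov_op a q = \int[m]_q a q.
Proof.
move=> ba; elim: n => //= n IH; rewrite Rintegral_markov//.
exact: bmeas_iter_markov.
Qed.

Lemma sym_iter a n k l : bmeas a ->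
  \int[m]_q (iter (n + k) markov_op a q * iter l markov_op a q) =
  \int[m]_q (iter n markov_op a q * iter (l + k) markov_op a q).
Proof.
move=> ba; elim: k l => [|k IH] l; first by rewrite !addn0.
rewrite addnS iterS sym ?IH; [|exact: bmeas_iter_markov..].
by rewrite -iterS IH addSnnS.
Qed.

Definition fiber_variance a q := \int[w]_p (a (Phi (q, p)) - markov_op a q) ^+ 2.

Lemma fiber_varianceE a q : bmeas a ->
  fiber_variance a q = markov_op (fun x => a x ^+ 2) q - markov_op a q ^+ 2.
Proof.
move=> ba; have bs := bmeas_section q ba; set k := markov_op a q.
have kE : \int[w]_p a (Phi (q, p)) = k by [].
have E p : (a (Phi (q, p)) - k) ^+ 2 =
    a (Phi (q, p)) ^+ 2 - (2 * k) * a (Phi (q, p)) + k ^+ 2 by ring.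
rewrite /fiber_variance -/k; under eq_Rintegral do rewrite E.
have b1 := bmeasX 2 bs; have b2 := bmeasM (bmeas_cst (2 * k)) bs.
rewrite bmeas_RintegralD; [|exact: bmeasB|exact: (bmeas_cst (k ^+ 2))].
rewrite bmeas_RintegralB// bmeas_RintegralZl// kE (Rintegral_probability_cst w (k ^+ 2)).
by rewrite /markov_op; ring.
Qed.

Lemma bmeas_fiber_variance a : bmeas a -> bmeas (fiber_variance a).
Proof.
move=> ba; have -> : fiber_variance a =
    (fun q => markov_op (fun x => a x ^+ 2) q - markov_op a q ^+ 2).
  by apply/funext => q; exact: fiber_varianceE.
by apply: bmeasB; [exact/bmeas_markov/bmeasX|exact/bmeasX/bmeas_markov].
Qed.

Lemma fiber_variance_ge0 a q : 0 <= fiber_variance a q.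
Proof. by apply: Rintegral_ge0 => p _; exact: sqr_ge0. Qed.

Lemma Rintegral_fiber_variance a : bmeas a ->
  \int[m]_q fiber_variance a q =
  \int[m]_q (a q ^+ 2) - \int[m]_q (markov_op a q ^+ 2).
Proof.
move=> ba; under eq_Rintegral do rewrite fiber_varianceE//.
have ba2 := bmeasX 2 ba.
rewrite bmeas_RintegralB; [|exact: bmeas_markov|exact/bmeasX/bmeas_markov].
by rewrite Rintegral_markov.
Qed.

(** The defect is the integral of a variance. *)
Lemma markov_contraction2 a : bmeas a ->
  \int[m]_q (markov_op a q ^+ 2) <= \int[m]_q (a q ^+ 2).
Proof.
move=> ba; rewrite -subr_ge0 -Rintegral_fiber_variance//.
by apply: Rintegral_ge0 => q _; exact: fiber_variance_ge0.
Qed.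

Lemma markov_contraction1 a b : bmeas a -> bmeas b ->
  \int[m]_q `|markov_op a q - markov_op b q| <= \int[m]_q `|a q - b q|.
Proof.
move=> ba bb; have bab := bmeas_norm (bmeasB ba bb).
rewrite -[leRHS]Rintegral_markov//; apply: bmeas_le_Rintegral.
- by apply/bmeas_norm/bmeasB; exact: bmeas_markov.
- exact: bmeas_markov.
move=> q; rewrite -markovB//; apply: bmeas_le_normr_Rintegral.
by apply: (bmeas_section q (a := fun x => a x - b x)); exact: bmeasB.
Qed.

Hypothesis cov : {ae m, forall q, covers m w (fun p => Phi (q, p))}.
Hypothesis m_gt0 : (0 < m setT)%E.

(** If no energy is lost then the variance along almost every fiber vanishes: for
    some [q], [a] takes the single value [markov_op a q] on the image under
    [Phi (q, _)] of the complement of a null set, and this image is conull. *)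
Lemma markov_rigidity a : bmeas a ->
  \int[m]_q (markov_op a q ^+ 2) = \int[m]_q (a q ^+ 2) ->
  exists c, {ae m, forall q, a q = c}.
Proof.
move=> ba eqa.
have /bmeas_Rintegral_eq0 : \int[m]_q fiber_variance a q = 0.
  by rewrite Rintegral_fiber_variance// eqa subrr.
move=> /(_ (bmeas_fiber_variance ba) (@fiber_variance_ge0 a)) v0.
have [q [covq vq]] : exists q, covers m w (fun p => Phi (q, p)) /\ fiber_variance a q = 0.
  apply: contrapT => nex.
  have : {ae m, forall q : Q, False}.
    by apply: filterS2 cov v0 => q cq vq; apply: nex; exists q.
  move=> [Z [mZ mZ0 subZ]]; have ZT : Z = setT.
    by apply/seteqP; split=> // x _; exact: subZ.
  by move: m_gt0; rewrite -ZT mZ0 ltxx.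
have bs := bmeas_section q ba.
set k := markov_op a q.
have bk : bmeas (fun p => a (Phi (q, p)) - k) := bmeasB bs (bmeas_cst k).
have /covq := bmeas_Rintegral_eq0 (bmeasX 2 bk) (fun p => sqr_ge0 _) vq.
rewrite setCK => imq; exists k; apply: negligibleS imq => x /= axk [p pk px].
by apply: axk; rewrite -px; apply/eqP; rewrite -subr_eq0 -sqrf_eq0; apply/eqP.
Qed.

Definition mean a : R := (\int[m]_q a q) / fine (m setT).

Let mT_gt0 : 0 < fine (m setT).
Proof. by rewrite fine_gt0// m_gt0/= ltey_eq fin_num_measure. Qed.

Let energy a n := \int[m]_q (iter n markov_op a q ^+ 2).

Let energy_ge0 a n : 0 <= energy a n.
Proof. by apply: Rintegral_ge0 => q _; exact: sqr_ge0. Qed.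

Let energy_noninc a : bmeas a -> {homo energy a : n k / (n <= k)%N >-> k <= n}.
Proof.
move=> ba; apply/nonincreasing_seqP => n; apply: markov_contraction2.
exact: bmeas_iter_markov.
Qed.

Let energy_cvg a : bmeas a -> energy a @ \oo --> limn (energy a).
Proof.
move=> ba; apply: nonincreasing_is_cvgn; first exact: energy_noninc.
by exists 0 => _ [n _ <-].
Qed.

Let energy_ge_lim a n : bmeas a -> limn (energy a) <= energy a n.
Proof.
move=> ba; apply: nonincreasing_cvgn_ge; first exact: energy_noninc.
exact: energy_cvg.
Qed.

(** By symmetry one operator at a time can be moved from one factor to the other,
    so the integral depends only on [i + j]. *)
Lemma Rintegral_iterM a i j n : bmeas a -> (i + j = n + n)%N ->
  \int[m]_q (iter i markov_op a q * iter j markov_op a q) = energy a n.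
Proof.
by move=> ba ijn; rewrite -[X in iter X](add0n i) sym_iter// addnC ijn -sym_iter.
Qed.

(** Expand the square: the cross term is the energy at the half-sum [k + i] of
    the two times, an integer because both times are even; it is at least the
    energy at time [k.*2] and at least the limit of the energies. *)
Lemma iter_markov_dist2 a i k : bmeas a -> (i <= k)%N ->
  \int[m]_q (iter k.*2 markov_op a q - iter i.*2 markov_op a q) ^+ 2 <=
  energy a i - limn (energy a).
Proof.
move=> ba ik; have bi n : bmeas (iter n markov_op a) by exact: bmeas_iter_markov.
set v := fun n => iter n markov_op a.
have E q : (v k.*2 q - v i.*2 q) ^+ 2 =
    v k.*2 q ^+ 2 - 2 * (v k.*2 q * v i.*2 q) + v i.*2 q ^+ 2 by ring.
under eq_Rintegral do rewrite E.
have b2 n : bmeas (fun q => v n q ^+ 2) := bmeasX 2 (bi n).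
have bM : bmeas (fun q => v k.*2 q * v i.*2 q) := bmeasM (bi _) (bi _).
have b2M := bmeasM (bmeas_cst 2) bM.
rewrite bmeas_RintegralD//; last exact: (bmeasB (b2 _) b2M).
rewrite bmeas_RintegralB// bmeas_RintegralZl//.
rewrite (@Rintegral_iterM a k.*2 i.*2 (k + i))//; last by rewrite -doubleD addnn.
have h1 : energy a k.*2 <= energy a (k + i).
  by apply: energy_noninc => //; rewrite -addnn leq_add2l.
have h2 : energy a i.*2 <= energy a i.
  by apply: energy_noninc => //; rewrite -addnn leq_addr.
have h3 := energy_ge_lim (k + i) ba.
by rewrite -/(energy a k.*2) -/(energy a i.*2); lra.
Qed.

(** The limit [psi] of a rapidly converging subsequence of the even iterates.  The
    energies of [psi] and [markov_op psi] are limits of energies of iterates at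
    even and at odd times, and both equal the limit of all energies. *)
Lemma iter_markov_ae_limit a : bmeas a -> exists (s : nat -> nat) psi,
  [/\ forall j, (j <= s j)%N, bmeas psi,
      (fun j => \int[m]_q `|iter (s j) markov_op a q - psi q|) @ \oo --> (0 : R) &
      \int[m]_q (markov_op psi q ^+ 2) = \int[m]_q (psi q ^+ 2)].
Proof.
move=> ba; have [ma [A aA]] := ba.
have bi n : bmeas (iter n markov_op a) by exact: bmeas_iter_markov.
have mi n : measurable_fun setT (iter n markov_op a) by exact: measurable_iter_markov.
have iA n q : `|iter n markov_op a q| <= A by exact: iter_markov_le.
set L := limn (energy a).
have /choice[N NP] j : exists N, forall n, (N <= n)%N ->
    energy a n - L <= (2 ^ j.+1)%:R^-1 ^+ 2.
  have e0 : 0 < (2 ^ j.+1)%:R^-1 ^+ 2 :> R by rewrite exprn_gt0// invr_gt0 ltr0n expn_gt0.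
  have := (cvgrPdist_le _ _).1 (energy_cvg ba) _ e0.
  move=> [N _ NP]; exists N => n Nn; rewrite (le_trans _ (NP n Nn))//.
  by rewrite distrC ler_norm.
(* The sum makes [e] nondecreasing and at least [N]; the summand [j] makes it
   tend to infinity. *)
pose e j := (j + \sum_(i < j.+1) N i)%N.
have eS j : (e j <= e j.+1)%N.
  by rewrite /e (big_ord_recr j.+1)/= addnA addSn leqW// leq_addr.
have je j : (j <= e j)%N by rewrite leq_addr.
have Ne j : (N j <= e j)%N.
  by rewrite /e big_ord_recr/= addnA leq_addl.
pose x j := iter (e j).*2 markov_op a.
have [||j|psi [bpsi xpsi]] := @fast_cauchy_ae_limit _ _ _ m x A.
- by move=> n; exact: mi.
- by move=> n; exact: iA.
- by apply: le_trans (iter_markov_dist2 ba (eS j)) _; exact: NP.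
have je2 j : (j <= (e j).*2)%N by rewrite -addnn (leq_trans (je j))// leq_addr.
have cvg1 := bmeas_bounded_convergence (fun j => mi _) (fun j => iA _) bpsi xpsi.
exists (fun j => (e j).*2), psi; split => //.
have cpsi : (fun j => energy a (e j).*2) @ \oo --> \int[m]_q (psi q ^+ 2).
  exact: bmeas_Rintegral_sqr_cvg.
have cKpsi : (fun j => energy a (e j).*2.+1) @ \oo -->
    \int[m]_q (markov_op psi q ^+ 2).
  apply: (@bmeas_Rintegral_sqr_cvg _ _ _ m
    (fun j => iter (e j).*2.+1 markov_op a) (markov_op psi) A) => //.
    exact: bmeas_markov.
  apply: (squeeze_cvgr _ (cvg_cst 0) cvg1); apply: nearW => j.
  by rewrite Rintegral_ge0//= markov_contraction1.
have cL : (fun j => energy a (e j).*2) @ \oo --> L.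
  by apply: (cvg_subseq_ge (u := energy a) (s := fun j => (e j).*2)) => //; exact: energy_cvg.
have cKL : (fun j => energy a (e j).*2.+1) @ \oo --> L.
  apply: (cvg_subseq_ge (u := energy a) (s := fun j => (e j).*2.+1)) => [j|].
    exact: leqW.
  exact: energy_cvg.
by rewrite (cvg_unique (@Rhausdorff R) cpsi cL) (cvg_unique (@Rhausdorff R) cKpsi cKL).
Qed.

(** [K^n a - c] is the [n]-th iterate of [a - c], hence its [L^2] norm is
    nonincreasing, and convergence along a subsequence suffices. *)
Lemma iter_markov_cvg2 a : bmeas a ->
  (fun n => \int[m]_q (iter n markov_op a q - mean a) ^+ 2) @ \oo --> (0 : R).
Proof.
move=> ba; have [ma [A aA]] := ba.
have [s [psi [js bpsi cvg1 Kpsi]]] := iter_markov_ae_limit ba.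
have bi n : bmeas (iter n markov_op a) by exact: bmeas_iter_markov.
have mi n : measurable_fun setT (iter n markov_op a) by exact: measurable_iter_markov.
have iA n q : `|iter n markov_op a q| <= A by exact: iter_markov_le.
have [c psic] := markov_rigidity bpsi Kpsi.
have int_psi (F : R -> R) : measurable_fun setT F ->
    \int[m]_q F (psi q) = F c * fine (m setT).
  move=> mF; rewrite -Rintegral_cst// /Rintegral; congr fine.
  apply: ae_eq_integral => //.
  - by apply/measurable_EFinP; apply: measurableT_comp => //; case: bpsi.
  - by apply: filterS psic => q /= ->.
have -> : mean a = c.
  have : (fun j => \int[m]_q iter (s j) markov_op a q) @ \oo --> \int[m]_q psi q.
    exact: (bmeas_Rintegral_cvg (fun j => mi (s j)) (fun j => iA (s j))).
  under eq_fun do rewrite Rintegral_iter_markov//.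
  move=> /(cvg_unique (@Rhausdorff R) (cvg_cst _)).
  rewrite /mean => ->; rewrite (int_psi id)//.
  by rewrite mulfK// gt_eqF.
pose D n := \int[m]_q (iter n markov_op a q - c) ^+ 2.
have bc n : bmeas (fun q => iter n markov_op a q - c).
  by apply: (bmeasB (bi n)); exact: (bmeas_cst c).
have D_noninc : {homo D : n k / (n <= k)%N >-> k <= n}.
  apply/nonincreasing_seqP => n; rewrite /D.
  have -> : (fun q => (iter n.+1 markov_op a q - c) ^+ 2) =
      (fun q => markov_op (fun x => iter n markov_op a x - c) q ^+ 2).
    apply/funext => q; rewrite (markovB q (bi n) (bmeas_cst c)).
    by rewrite -/(cst c) markov_cst.
  exact: markov_contraction2.
have D_cvg : cvgn D.
  apply: nonincreasing_is_cvgn => //; exists 0 => _ [n _ <-].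
  by apply: Rintegral_ge0 => q _; exact: sqr_ge0.
have Ds : (D \o s) @ \oo --> (0 : R).
  have -> : 0 = \int[m]_q (psi q - c) ^+ 2 :> R.
    rewrite (int_psi (fun y => (y - c) ^+ 2)); first by rewrite subrr expr0n mul0r.
    by apply: measurable_funX; apply: measurable_funB.
  apply: (@bmeas_Rintegral_sqr_cvg _ _ _ m
    (fun j q => iter (s j) markov_op a q - c) (fun q => psi q - c) (A + `|c|)).
  - by move=> j; case: (bc (s j)).
  - by move=> j q; rewrite (le_trans (ler_normB _ _))// lerD.
  - exact: (bmeasB bpsi (bmeas_cst c)).
  - by under eq_fun do under eq_Rintegral do rewrite opprB addrA subrK.
have : (D \o s) @ \oo --> limn D by exact: cvg_subseq_ge.
by move=> /(cvg_unique (@Rhausdorff R) Ds) E; rewrite E; exact: D_cvg.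
Qed.

(** The image of [m \x w] under [Phi] is [m]: on indicator functions this is
    [Rintegral_markov]. *)
Lemma ge0_integral_markov (F : Q -> \bar R) : measurable_fun setT F ->
  (forall q, 0 <= F q)%E ->
  (\int[m]_q \int[w]_p F (Phi (q, p)) = \int[m]_q F q)%E.
Proof.
move=> mF F0.
rewrite -(@fubini_tonelli1 _ _ _ _ _ m w (F \o Phi)
  (measurableT_comp mF mPhi) (fun z => F0 (Phi z))).
rewrite -(ge0_integral_pushforward mPhi (m \x w)%E measurableT)//.
apply: eq_measure_integral => E mE _ /=.
rewrite /pushforward /product_measure1.
have bE : bmeas (\1_E : Q -> R).
  split; first exact: measurable_indic.
  by exists 1 => q; rewrite indicE; case: (q \in E); rewrite ?normr1 ?normr0.
have -> : (m E = \int[m]_q (\1_E q)%:E)%E by rewrite integral_indic// setIT.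
rewrite -bmeas_EFin_Rintegral// -Rintegral_markov// bmeas_EFin_Rintegral//; last first.
  exact: bmeas_markov.
apply: eq_integral => q _; rewrite /markov_op bmeas_EFin_Rintegral/=; last first.
  exact: (bmeas_section q bE).
have mS : measurable (xsection (Phi @^-1` E) q).
  by apply: measurable_xsection; rewrite -[X in measurable X]setTI; exact: mPhi.
rewrite -[in LHS](setIT (xsection _ _)) -integral_indic//.
apply: eq_integral => p _.
by rewrite !indicE; congr ((_ : bool)%:R%:E); apply/idP/idP; rewrite !inE /xsection/= !inE.
Qed.

Lemma ae_integrable_section a : m.-integrable setT (EFin \o a) ->
  {ae m, forall q, w.-integrable setT (fun p => (a (Phi (q, p)))%:E)}.
Proof.
move=> ia; apply: (@ae_integrable1 _ _ _ _ _ m w (EFin \o a \o Phi)).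
have maP : measurable_fun setT (EFin \o a \o Phi).
  by apply: measurableT_comp mPhi; exact: measurable_int ia.
apply/(integrable12ltyP _ _ maP).
rewrite (ge0_integral_markov (F := fun q => `|(a q)%:E|%E))//.
  by case/integrableP : ia.
by apply: measurableT_comp => //; exact: measurable_int ia.
Qed.

(** [Phi] pulls [m]-null sets back to [(m \x w)]-null sets. *)
Lemma ae_section (S : Q -> Prop) : {ae m, forall q, S q} ->
  {ae m, forall q, {ae w, forall p, S (Phi (q, p))}}.
Proof.
move=> [N [mN N0 SN]].
have mI : measurable_fun setT (fun q => (\1_N q)%:E : \bar R).
  by apply/measurable_EFinP; exact: measurable_indic.
have I0 (q : Q) : (0 <= (\1_N q)%:E :> \bar R)%E by rewrite lee_fin.
have mF := measurable_fun_fubini_tonelli_F (m2 := w)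
  (fun z => (\1_N (Phi z))%:E) (measurableT_comp mI mPhi) (fun z => I0 (Phi z)).
have : (\int[m]_q `|\int[w]_p (\1_N (Phi (q, p)))%:E| = 0)%E.
  under eq_integral do rewrite gee0_abs ?integral_ge0//.
  by rewrite (ge0_integral_markov mI I0) integral_indic// setIT.
move=> /(ae_eq_integral_abs m measurableT mF); apply: filterS => q /(_ I) q0.
have mq : measurable ((fun p => Phi (q, p)) @^-1` N).
  rewrite -[X in measurable X]setTI.
  exact: (measurable_fun_pair2 q mPhi).
exists ((fun p => Phi (q, p)) @^-1` N); split => //; last by move=> p; exact: SN.
by move: q0 => /= <-; rewrite -[LHS](congr1 w (setIT _)) -integral_indic.
Qed.

Definition Lr r a := measurable_fun setT a /\ (abs_moment m r a < +oo)%E.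

(** Stated for differences so that it controls iterates of two functions without
    appealing to linearity, which fails at points where an integral is junk. *)
Lemma markov_contraction r a b : 1 <= r -> Lr r a -> Lr r b ->
  (abs_moment m r (fun q => markov_op a q - markov_op b q)%R <=
   abs_moment m r (fun q => a q - b q)%R)%E.
Proof.
move=> r1 [ma ar] [mb br].
have mab : measurable_fun setT (fun q => a q - b q) by exact: measurable_funB.
rewrite -[leRHS](ge0_integral_markov (F := fun q => (`|a q - b q| `^ r)%:E)).
- apply: ae_ge0_le_integral => //.
  + by apply: measurable_norm_powR; apply: measurable_funB; exact: measurable_markov.
  + by move=> q _; apply: integral_ge0 => p _; rewrite lee_fin powR_ge0.
  + apply: (@measurable_fun_fubini_tonelli_F _ _ _ _ _ w
      (fun z => (`|a (Phi z) - b (Phi z)| `^ r)%:E)).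
      apply: (measurable_norm_powR r (a := (fun q => a q - b q) \o Phi)).
      exact: measurableT_comp.
    by move=> z; rewrite lee_fin powR_ge0.
  + have := ae_integrable_section (abs_moment_integrable r1 ma ar).
    have := ae_integrable_section (abs_moment_integrable r1 mb br).
    apply: filterS2 => q iq2 iq1 _; rewrite /markov_op -RintegralB//.
    by apply: jensen_powR => //; exact: (integrableB measurableT iq1 iq2).
- exact: measurable_norm_powR.
- by move=> q; rewrite lee_fin powR_ge0.
Qed.

Lemma Lr_cst r c : 0 <= r -> Lr r (cst c).
Proof. by move=> r0; split=> //; apply: abs_moment_bmeas => //; exact: bmeas_cst. Qed.

Lemma Lr_markov r a : 1 <= r -> Lr r a -> Lr r (markov_op a).
Proof.
move=> r1 La; split; first exact: measurable_markov La.1.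
have := markov_contraction r1 La (Lr_cst 0 (le_trans ler01 r1)).
rewrite markov_cst; under [X in (abs_moment _ _ X <= _)%E]eq_fun do rewrite subr0.
under [X in (_ <= abs_moment _ _ X)%E]eq_fun do rewrite subr0.
by move=> /le_lt_trans; apply; exact: La.2.
Qed.

Lemma Lr_iter_markov r a n : 1 <= r -> Lr r a -> Lr r (iter n markov_op a).
Proof.
by move=> r1 La; elim: n => [|n IH]; [exact: La|rewrite iterS; exact: Lr_markov].
Qed.

Lemma iter_markov_contraction r a b n : 1 <= r -> Lr r a -> Lr r b ->
  (abs_moment m r (fun q => iter n markov_op a q - iter n markov_op b q)%R <=
   abs_moment m r (fun q => a q - b q)%R)%E.
Proof.
move=> r1 La Lb; elim: n => [|n IH]; first exact: lexx.
have Ln c : Lr r c -> Lr r (iter n markov_op c) by exact: Lr_iter_markov.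
exact: le_trans (markov_contraction r1 (Ln _ La) (Ln _ Lb)) IH.
Qed.

(** For [0 <= x <= B] and [0 < dl], [x `^ r <= dl `^ r + (B `^ r / dl ^+ 2) * x ^+ 2]:
    either [x <= dl], or [1 <= x / dl].  This reduces every exponent to [2]. *)
Lemma iter_markov_cvg_bmeas r a : 0 < r -> bmeas a ->
  (fun n => abs_moment m r (fun q => iter n markov_op a q - mean a)%R) @ \oo --> 0%E.
Proof.
move=> r0 ba; apply/cvge0P => [n|e e0]; first exact: abs_moment_ge0.
have [ma [A aA]] := ba; set B := A + `|mean a|.
have iA n q : `|iter n markov_op a q - mean a| <= B.
  by rewrite (le_trans (ler_normB _ _))// lerD// iter_markov_le.
(* [dl `^ r] integrates to [e / 2]. *)
pose dl := (e / 2 / fine (m setT)) `^ r^-1.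
have dl0 : 0 < dl by rewrite powR_gt0// !divr_gt0.
have dlr : dl `^ r = e / 2 / fine (m setT).
  by rewrite /dl -powRrM mulVf ?gt_eqF// powRr1// ltW// !divr_gt0.
pose K := B `^ r / dl ^+ 2.
have pw x : 0 <= x -> x <= B -> x `^ r <= dl `^ r + K * x ^+ 2.
  move=> x0 xB; have [xd|/ltW dx] := leP x dl.
    rewrite (@le_trans _ _ (dl `^ r))//.
      by apply: ge0_ler_powR; rewrite ?nnegrE// ltW.
    by rewrite lerDl mulr_ge0 ?sqr_ge0// divr_ge0 ?powR_ge0 ?sqr_ge0.
  apply: (@le_trans _ _ (B `^ r)).
    by apply: ge0_ler_powR; rewrite ?nnegrE// ?(ltW r0)// (le_trans x0).
  rewrite (@le_trans _ _ (K * x ^+ 2))//; last by rewrite lerDr powR_ge0.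
  rewrite /K mulrAC ler_pdivlMr ?exprn_gt0// ler_wpM2l ?powR_ge0//.
  by rewrite lerXn2r// nnegrE// ltW.
have : (fun n => K * \int[m]_q (iter n markov_op a q - mean a) ^+ 2) @ \oo --> (0 : R).
  by rewrite -(mulr0 K); apply: cvgMr; exact: iter_markov_cvg2.
have e2 : 0 < e / 2 by rewrite divr_gt0.
move=> /cvgr0Pnorm_le/(_ _ e2); apply: filterS => n Kn.
have bi : bmeas (fun q => iter n markov_op a q - mean a).
  exact: (bmeasB (bmeas_iter_markov n ba) (bmeas_cst (mean a))).
have b2 := bmeasX 2 bi.
have bK : bmeas (fun q => K * (iter n markov_op a q - mean a) ^+ 2).
  exact: (bmeasM (bmeas_cst K) b2).
have bd : bmeas (fun q : Q => dl `^ r) := bmeas_cst (dl `^ r).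
have -> : e = dl `^ r * fine (m setT) + e / 2.
  by rewrite dlr divfK ?gt_eqF// -splitr.
apply: (@le_trans _ _ (\int[m]_q (dl `^ r + K * (iter n markov_op a q - mean a) ^+ 2)%:E)%E).
  apply: ge0_le_integral => //.
  - by apply: measurable_norm_powR; case: bi.
  - by apply/measurable_EFinP; case: (bmeasD bd bK).
  - by move=> q _; rewrite lee_fin -(real_normK (num_real _)) pw.
rewrite -bmeas_EFin_Rintegral; last exact: (bmeasD bd bK).
rewrite lee_fin bmeas_RintegralD// bmeas_RintegralZl// Rintegral_cst// lerD2l.
exact: le_trans (ler_norm _) Kn.
Qed.

Lemma mean_dist_le a b : m.-integrable setT (EFin \o a) -> bmeas b ->
  ((`|mean a - mean b| * fine (m setT))%:E <=
    abs_moment m 1 (fun q => a q - b q)%R)%E.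
Proof.
move=> ia bb; have ib := bmeas_integrable m bb.
rewrite -(ger0_norm (ltW mT_gt0)) -normrM mulrBl /mean !divfK ?gt_eqF//.
rewrite -RintegralB// EFin_normr_Rintegral//; last exact: (integrableB _ ia ib).
have iab : m.-integrable setT (EFin \o (fun q => a q - b q)%R).
  exact: (integrableB measurableT ia ib).
apply: (le_trans (le_abse_integral m measurableT (measurable_int _ iab))).
by rewrite /abs_moment; under [leRHS]eq_integral do rewrite powRr1//.
Qed.

(** Three errors: the contraction bounds the effect of truncating [a] uniformly in
    [n], the bounded case handles the truncation [b], and the means of [a] and
    [b] are close. *)
Lemma iter_markov_cvg r a : 1 <= r -> Lr r a ->
  (fun n => abs_moment m r (fun q => iter n markov_op a q - mean a)%R) @ \oo --> 0%E.
Proof.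
move=> r1 La; have [ma ar] := La; have r0 : 0 < r := lt_le_trans ltr01 r1.
have ia := abs_moment_integrable r1 ma ar.
have a1 : (abs_moment m 1 a < +oo)%E.
  rewrite /abs_moment; under eq_integral do rewrite powRr1//.
  by case/integrableP : ia.
apply/cvge0P => [n|e e0]; first exact: abs_moment_ge0.
set C := 2 `^ r; have C0 : 0 < C by rewrite powR_gt0.
(* [abs_momentD_le] is applied twice, so that the three errors are multiplied
   by [C], [C ^+ 2] and [C ^+ 2]; [e3] also keeps the difference of the means
   below [1], where its [r]-th power is at most itself. *)
pose e1 := e / 3 / C; have e10 : 0 < e1 by rewrite !divr_gt0.
pose e2 := e1 / C; have e20 : 0 < e2 by rewrite divr_gt0.
pose e3 := Num.min (fine (m setT)) e2.
have e30 : 0 < e3 by rewrite lt_min mT_gt0.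
have /cvge0P - /(_ (fun k => abs_moment_ge0 _ _ _) _ e10) tr1 := truncate_cvg r0 ma ar.
have /cvge0P - /(_ (fun k => abs_moment_ge0 _ _ _) _ e30) tr2 := truncate_cvg ltr01 ma a1.
have [k [kr k1]] : exists k, (abs_moment m r (fun x => a x - truncate k a x)%R <= e1%:E)%E /\
    (abs_moment m 1 (fun x => a x - truncate k a x)%R <= e3%:E)%E.
  have [N _ NP] : \forall k \near \oo,
      (abs_moment m r (fun x => a x - truncate k a x)%R <= e1%:E)%E /\
      (abs_moment m 1 (fun x => a x - truncate k a x)%R <= e3%:E)%E.
    by apply: filterS2 tr1 tr2.
  by exists N; exact: (NP N (leqnn N)).
set b := truncate k a in kr k1; have bb : bmeas b := bmeas_truncate k ma.
have Lb : Lr r b by split; [case: bb|exact: abs_moment_bmeas (ltW r0) bb].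
have cle := le_trans (mean_dist_le ia bb) k1; rewrite lee_fin in cle.
have cr : (abs_moment m r (cst (mean b - mean a)%R) <= e2%:E)%E.
  rewrite abs_moment_cst lee_fin distrC.
  have c1 : `|mean a - mean b| <= 1.
    by rewrite -(ler_pM2r mT_gt0) mul1r (le_trans cle)// ge_min lexx.
  apply: (@le_trans _ _ (`|mean a - mean b| * fine (m setT))).
    apply: ler_wpM2r; first exact: ltW.
    have [->|cn0] := eqVneq (mean a - mean b) 0; first by rewrite normr0 powR0 ?lexx ?gt_eqF.
    by rewrite ge1r_powR// normr_gt0 cn0 c1.
  by rewrite (le_trans cle)// ge_min lexx orbT.
have /cvge0P - /(_ (fun k => abs_moment_ge0 _ _ _) _ e20) := iter_markov_cvg_bmeas r0 bb.
apply: filterS => n nb.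
have mi c : measurable_fun setT c -> measurable_fun setT (iter n markov_op c).
  exact: measurable_iter_markov.
have mb : measurable_fun setT b by case: bb.
have -> : (fun q => iter n markov_op a q - mean a) =
    (fun q => (iter n markov_op a q - iter n markov_op b q) +
      ((iter n markov_op b q - mean b) + (mean b - mean a))).
  by apply/funext => q; ring.
have m1 : measurable_fun setT (fun q => iter n markov_op a q - iter n markov_op b q).
  by apply: measurable_funB; exact: mi.
have m2 : measurable_fun setT (fun q => iter n markov_op b q - mean b).
  by apply: measurable_funB => //; exact: mi.
have m3 : measurable_fun setT (cst (mean b - mean a) : Q -> R) by [].
apply: (le_trans (abs_momentD_le m r0 m1 (measurable_funD m2 m3))).
have -> : e = C * (e1 + C * (e2 + e2)) by rewrite /e2 /e1; field; rewrite gt_eqF.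
have C0E : (0 <= C%:E)%E by rewrite lee_fin ltW.
rewrite EFinM; apply: (lee_wpmul2l C0E); rewrite EFinD.
apply: leeD; first exact: le_trans (iter_markov_contraction n r1 La Lb) kr.
apply: (le_trans (abs_momentD_le m r0 m2 m3)).
by rewrite EFinM; apply: (lee_wpmul2l C0E); rewrite EFinD; exact: leeD nb cr.
Qed.

End MarkovOperator.

(** * Measures with a density *)

Section Density.
Context {d : measure_display} {T : measurableType d} {R : realType}.
Variables (mu : {sigma_finite_measure set T -> \bar R}) (f : T -> R).
Hypotheses (mf : measurable_fun setT f) (f0 : forall x, 0 <= f x)
  (fi : (\int[mu]_x (f x)%:E < +oo)%E).

(** The proofs are arguments so that the measure, finite-measure and probability
    structures attach to the term itself. *)
Definition density & measurable_fun setT f & (forall x, 0 <= f x)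
    & (\int[mu]_x (f x)%:E < +oo)%E : set T -> \bar R :=
  fun A => (\int[mu]_(x in A) (f x)%:E)%E.

Local Notation m := (density mf f0 fi).

Let m0 : m set0 = 0%E. Proof. exact: integral_set0. Qed.

Let m_ge0 A : (0 <= m A)%E.
Proof. by apply: integral_ge0 => x _; rewrite lee_fin. Qed.

Let m_sigma_additive : semi_sigma_additive m.
Proof.
apply: semi_sigma_additive_nng_induced => [|x]; last by rewrite lee_fin.
exact/measurable_EFinP.
Qed.

HB.instance Definition _ := isMeasure.Build _ _ _ m m0 m_ge0 m_sigma_additive.

Let m_fin : fin_num_fun m.
Proof.
apply: lty_fin_num_fun; exact: fi.
Qed.

HB.instance Definition _ := @Measure_isFinite.Build _ _ _ m m_fin.

Let m_dom : m `<< mu.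
Proof.
apply/null_content_dominatesP => A mA A0.
apply: null_set_integral => //=.
by apply: measurable_funTS; exact/measurable_EFinP.
Qed.

Let f_integrable : mu.-integrable setT (EFin \o f).
Proof.
apply/integrableP; split; first exact/measurable_EFinP.
by under eq_integral do rewrite gee0_abs ?lee_fin//.
Qed.

(** The density [f] agrees almost everywhere with the Radon-Nikodym derivative of
    the measure it defines, for which the change of variables is known. *)
Lemma ge0_integral_density (F : T -> \bar R) : measurable_fun setT F ->
  (forall x, 0 <= F x)%E ->
  (\int[m]_x F x = \int[mu]_x (F x * (f x)%:E))%E.
Proof.
move=> mF F0.
have mRN : measurable_fun setT (Radon_Nikodym_SigmaFinite.f m mu).
  exact: measurable_int (Radon_Nikodym_SigmaFinite.f_integrable m_dom).
rewrite -(Radon_Nikodym_SigmaFinite.change_of_variables m_dom F0 measurableT mF).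
apply: ae_eq_integral => //.
- exact: emeasurable_funM.
- by apply: emeasurable_funM => //; exact/measurable_EFinP.
- have : ae_eq mu setT (EFin \o f) (Radon_Nikodym_SigmaFinite.f m mu).
    apply: integral_ae_eq => // E _ mE.
    by rewrite -Radon_Nikodym_SigmaFinite.f_integral.
  by apply: filterS => x /(_ I) /= ->.
Qed.

Lemma Rintegral_density (a : T -> R) : measurable_fun setT a ->
  \int[m]_x a x = \int[mu]_x (a x * f x).
Proof.
move=> ma; rewrite /Rintegral; congr fine; rewrite integralE [RHS]integralE.
have mEa : measurable_fun setT (EFin \o a) by exact/measurable_EFinP.
congr (_ - _)%E; rewrite ge0_integral_density//.
- apply: eq_integral => x _.
  by rewrite !funeposE EFinM maxe_pMl ?mul0e// lee_fin.
- exact: measurable_funepos.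
- apply: eq_integral => x _.
  by rewrite !funenegE EFinM -mulNe maxe_pMl ?mul0e// lee_fin.
- exact: measurable_funeneg.
Qed.

Lemma integrable_density (a : T -> R) : measurable_fun setT a ->
  m.-integrable setT (EFin \o a) <->
  mu.-integrable setT (fun x => (a x * f x)%:E).
Proof.
move=> ma; have mEa : measurable_fun setT (EFin \o a) by exact/measurable_EFinP.
have mEaf : measurable_fun setT (fun x => (a x * f x)%:E).
  by apply/measurable_EFinP; exact: measurable_funM.
have E : (\int[m]_x `|(a x)%:E| = \int[mu]_x `|(a x * f x)%:E|)%E.
  rewrite ge0_integral_density//; last exact: measurableT_comp.
  by apply: eq_integral => x _; rewrite EFinM abseM (@gee0_abs _ (f x)%:E) ?lee_fin.
by split=> /integrableP[_ h]; apply/integrableP; split => //; rewrite ?E// -E.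
Qed.

Hypothesis f_gt0 : {ae mu, forall x, 0 < f x}.

Lemma negligible_density (A : set T) : m.-negligible A <-> mu.-negligible A.
Proof.
split=> -[N [mN N0 AN]].
  have [M [mM M0 fM]] := f_gt0.
  have : (\int[mu]_(x in N) `|(f x)%:E| = 0)%E.
    by under eq_integral do rewrite gee0_abs ?lee_fin//.
  move/ae_eq_integral_abs => /(_ mN).
  have mfN : measurable_fun N (EFin \o f).
    by apply: measurable_funTS; exact/measurable_EFinP.
  move=> /(_ mfN) fN; have := negligibleU fN f_gt0.
  apply: negligibleS => x Ax /=.
  have [f0x|fx0] := ltP 0 (f x); last by right.
  left => /(_ (AN x Ax)) [] fx0; by rewrite fx0 ltxx in f0x.
exists N; split => //; apply: null_set_integral => //.
by apply: measurable_funTS; exact/measurable_EFinP.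
Qed.

End Density.

Section ProbabilityDensity.
Context {d : measure_display} {T : measurableType d} {R : realType}.
Variables (mu : {sigma_finite_measure set T -> \bar R}) (f : T -> R).
Hypotheses (mf : measurable_fun setT f) (f0 : forall x, 0 <= f x)
  (fi : (\int[mu]_x (f x)%:E < +oo)%E) (f1 : (\int[mu]_x (f x)%:E = 1)%E).

Definition probability_density : probability T R :=
  HB.pack_for (probability T R) (density mf f0 fi)
    (@Measure_isProbability.Build _ _ _ (density mf f0 fi) f1).

End ProbabilityDensity.

(** * Averaging along an invariant map *)

Lemma EFin_RintegralZl {R : realType} {d : measure_display}
    {T : measurableType d} (mu : {measure set T -> \bar R}) (c : R) (k : T -> R) :
  mu.-integrable setT (EFin \o k) ->
  (\int[mu]_x (c * k x)%:E)%E = (c * \int[mu]_x k x)%:E.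
Proof.
move=> ik; rewrite -RintegralZl// /Rintegral fineK//.
apply: integrable_fin_num => //; exact: (integrableZl measurableT c ik).
Qed.

Section HamiltonianTransfer.
Context {R : realType} {dQ dP : measure_display}.
Context {Q : measurableType dQ} {P : measurableType dP}.
Variables (mu : {sigma_finite_measure set Q -> \bar R})
  (nu : {sigma_finite_measure set P -> \bar R})
  (f : Q -> R) (g : P -> R) (H Hinv : Q * P -> Q * P).
Hypotheses (f_meas : measurable_fun setT f) (f_ge0 : forall q, 0 <= f q)
  (f_int_gt0 : (0 < \int[mu]_q (f q)%:E)%E)
  (f_int_lty : (\int[mu]_q (f q)%:E < +oo)%E)
  (g_meas : measurable_fun setT g) (g_ge0 : forall p, 0 <= g p)
  (g_gt0 : forall p, 0 < g p)
  (g_int_lty : (\int[nu]_p (g p)%:E < +oo)%E)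
  (g_int1 : (\int[nu]_p (g p)%:E = 1)%E)
  (H_meas : measurable_fun setT H) (Hinv_meas : measurable_fun setT Hinv)
  (HK : cancel H Hinv) (HinvK : cancel Hinv H)
  (H_density : tensor f g \o H = tensor f g)
  (H_measure : forall A : Q * P -> R,
     (mu \x nu)%E.-integrable setT (EFin \o A) ->
     (\int[(mu \x nu)%E]_z (A (H z))%:E = \int[(mu \x nu)%E]_z (A z)%:E)%E)
  (f_support : {ae mu, forall q, 0 < f q})
  (T_selfadjoint : forall h : Q -> R, mu.-integrable setT (EFin \o h) ->
     {ae mu, forall q, avg_op nu g Hinv h q = avg_op nu g H h q}).

Local Notation m := (density f_meas f_ge0 f_int_lty).
Local Notation w := (probability_density g_meas g_ge0 g_int_lty g_int1).

Definition position (z : Q * P) : Q := (H z).1.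

Local Notation K := (markov_op w position).

Let mpos : measurable_fun setT position.
Proof. exact: (measurableT_comp measurable_fst H_meas). Qed.

Let densityH z : f (H z).1 * g (H z).2 = f z.1 * g z.2.
Proof. by have := congr1 (fun F => F z) H_density. Qed.

Lemma ae_density (S : Q -> Prop) : {ae m, forall q, S q} <-> {ae mu, forall q, S q}.
Proof. exact: negligible_density. Qed.

Lemma ae_probability_density (S : P -> Prop) :
  {ae w, forall p, S p} <-> {ae nu, forall p, S p}.
Proof. by apply: negligible_density; exact: aeW. Qed.

Lemma markovE a q : measurable_fun setT a ->
  K a q = \int[nu]_p (a (position (q, p)) * g p).
Proof.
move=> ma; apply: Rintegral_density.
exact: (measurableT_comp ma (measurable_fun_pair2 q mpos)).
Qed.

Let integrable_tensor (c : Q * P -> R) : bmeas c ->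
  (mu \x nu)%E.-integrable setT (fun z => (c z * (f z.1 * g z.2))%:E).
Proof.
move=> [mc [M cM]].
have mfg : measurable_fun setT (fun z : Q * P => f z.1 * g z.2).
  apply: measurable_funM.
    exact: (measurableT_comp f_meas measurable_fst).
  exact: (measurableT_comp g_meas measurable_snd).
have ifg : (mu \x nu)%E.-integrable setT (fun z : Q * P => (f z.1 * g z.2)%:E).
  apply/integrable12ltyP; first exact/measurable_EFinP.
  rewrite (_ : (fun _ => _) = EFin \o f) => [//|].
  apply/funext => q /=.
  have -> : (fun p => `|(f q * g p)%:E|%E) = (fun p => (f q)%:E * (g p)%:E)%E.
    by apply/funext => p; rewrite gee0_abs ?lee_fin ?mulr_ge0.
  rewrite ge0_integralZl_EFin//; first by rewrite g_int1 mule1.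
  - by move=> p _; rewrite lee_fin.
  - exact/measurable_EFinP.
have bc : [bounded c x | x in [set: Q * P]].
  by exists M; split=> [|B MB z _]; [exact: num_real|exact: le_trans (cM z) (ltW MB)].
exact: (integrableMr measurableT mc bc ifg).
Qed.

Let integrable_tensor_section (c : Q * P -> R) q : bmeas c ->
  nu.-integrable setT (fun p => (c (q, p) * (f q * g p))%:E).
Proof.
move=> [mc [M cM]]; have mcq := measurable_fun_pair2 q mc.
have ig : nu.-integrable setT (fun p => (f q * g p)%:E).
  apply: (integrableZl measurableT (f q) (f := EFin \o g)).
  apply/integrableP; split; first exact/measurable_EFinP.
  by under eq_integral do rewrite gee0_abs ?lee_fin//.
have bc : [bounded c (q, x) | x in [set: P]].
  by exists M; split=> [|B MB z _]; [exact: num_real|exact: le_trans (cM _) (ltW MB)].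
exact: (integrableMr measurableT mcq bc ig).
Qed.

Let integrable_pos a q : bmeas a ->
  nu.-integrable setT (fun p => (a (position (q, p)) * g p)%:E).
Proof.
move=> ba; have bs := bmeas_section mpos q ba.
apply/(integrable_density g_meas g_ge0 g_int_lty); first by case: bs.
exact: bmeas_integrable.
Qed.

Lemma measurable_avg_op (G : Q * P -> Q * P) h : measurable_fun setT G ->
  measurable_fun setT h -> measurable_fun setT (avg_op nu g G h).
Proof.
move=> mG mh; apply: (measurable_Rintegral_snd nu (F := tensor h g \o G)).
apply: measurableT_comp mG; apply: measurable_funM.
  exact: (measurableT_comp mh measurable_fst).
exact: (measurableT_comp g_meas measurable_snd).
Qed.

(** Invariance of [f . g] turns the weight at the point [H (q, p)] into the weight
    [f q * g p], whose first factor leaves the integral: division by [f]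
    conjugates [T] to [K]. *)
Lemma avg_op_density a q : measurable_fun setT a ->
  w.-integrable setT (fun p => (a (position (q, p)))%:E) ->
  avg_op nu g H (fun x => a x * f x) q = K a q * f q.
Proof.
move=> ma ia; have map := measurableT_comp ma (measurable_fun_pair2 q mpos).
have iag := (integrable_density g_meas g_ge0 g_int_lty map).1 ia.
rewrite markovE// mulrC -RintegralZl//; apply: eq_Rintegral => p _.
by rewrite /tensor -mulrA densityH /=; ring.
Qed.

(** Moving [H] from one factor to the other: the integral of
    [a (Q z) * b q * f q * g p] is that of [a q * b (Q' z) * f q * g p], where
    [Q'] is the position component of [Hinv].  The inner integral over [p] is
    then [a q] times the adjoint average of [b * f], and self-adjointness turns
    it into an average along [H]. *)
Lemma markov_symmetric a b : bmeas a -> bmeas b ->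
  \int[m]_q (K a q * b q) = \int[m]_q (a q * K b q).
Proof.
move=> ba bb; have [ma [A aA]] := ba; have [mb [B bB]] := bb.
pose F z := a (position z) * b z.1 * (f z.1 * g z.2).
pose G z := a z.1 * b (Hinv z).1 * (f z.1 * g z.2).
have bapos : bmeas (a \o position).
  by split; [exact: measurableT_comp|exists A => z; exact: aA].
have bbfst : bmeas (fun z : Q * P => b z.1).
  by split; [exact: (measurableT_comp mb measurable_fst)|exists B].
have bafst : bmeas (fun z : Q * P => a z.1).
  by split; [exact: (measurableT_comp ma measurable_fst)|exists A].
have bbinv : bmeas (fun z : Q * P => b (Hinv z).1).
  split; last by exists B.
  exact: (measurableT_comp mb (measurableT_comp measurable_fst Hinv_meas)).
have iF := integrable_tensor (bmeasM bapos bbfst).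
have iG := integrable_tensor (bmeasM bafst bbinv).
have FGH z : F z = G (H z) by rewrite /F /G HK densityH.
have FG : (\int[mu]_q \int[nu]_p (F (q, p))%:E = \int[mu]_q \int[nu]_p (G (q, p))%:E)%E.
  rewrite [LHS](integral12_prod_meas1 iF) [RHS](integral12_prod_meas1 iG).
  by rewrite -(H_measure iG); apply: eq_integral => z _; congr EFin; exact: FGH.
have mK c : bmeas c -> measurable_fun setT (K c).
  by move=> [mc _]; exact: measurable_markov.
have RF q : (\int[nu]_p (F (q, p))%:E)%E = (K a q * b q * f q)%:E.
  rewrite (markovE _ ma) -mulrA mulrC -(EFin_RintegralZl _ (integrable_pos q ba)).
  by apply: eq_integral => p _; congr EFin; rewrite /F/=; ring.
have RG q : (\int[nu]_p (G (q, p))%:E)%E =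
    (a q * avg_op nu g Hinv (fun x => b x * f x) q)%:E.
  have -> : avg_op nu g Hinv (fun x => b x * f x) q =
      \int[nu]_p (b (Hinv (q, p)).1 * (f q * g p)).
    by apply: eq_Rintegral => p _; rewrite /tensor -mulrA -densityH HinvK.
  rewrite -(EFin_RintegralZl _ (integrable_tensor_section q bbinv)).
  by apply: eq_integral => p _; congr EFin; rewrite /G/= -mulrA.
have ibf : mu.-integrable setT (EFin \o (fun x => b x * f x)).
  apply/(integrable_density f_meas f_ge0 f_int_lty mb).
  exact: bmeas_integrable.
have mKab := measurable_funM (mK a ba) mb.
have maKb := measurable_funM ma (mK b bb).
rewrite (Rintegral_density _ _ _ mKab) (Rintegral_density _ _ _ maKb).
rewrite /Rintegral; congr fine.
transitivity (\int[mu]_q \int[nu]_p (F (q, p))%:E)%E.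
  by apply: eq_integral => q _; rewrite RF.
rewrite FG.
transitivity (\int[mu]_q
    (a q * avg_op nu g Hinv (fun x => (b x * f x)%R) q)%:E)%E.
  by apply: eq_integral => q _; exact: RG.
apply: (ae_eq_integral _ _ measurableT).
- apply/measurable_EFinP; apply: (measurable_funM ma).
  exact: (measurable_avg_op Hinv_meas (measurable_funM mb f_meas)).
- by apply/measurable_EFinP; exact: (measurable_funM maKb f_meas).
apply: filterS (T_selfadjoint ibf) => q Tq _ /=.
by rewrite Tq avg_op_density ?mulrA//; exact/bmeas_integrable/bmeas_section.
Qed.

Implicit Types (h k a b : Q -> R) (r : R).

(** As [h] may differ from [a * f] on a null set, this needs that [Q] pulls null
    sets back to null sets. *)
Lemma avg_op_ae_density h a : measurable_fun setT h -> measurable_fun setT a ->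
  m.-integrable setT (EFin \o a) -> {ae mu, forall q, h q = a q * f q} ->
  {ae mu, forall q, avg_op nu g H h q = K a q * f q}.
Proof.
move=> mh ma ia ha.
have s1 := ae_integrable_section mpos markov_symmetric ia.
have s2 := ae_section mpos markov_symmetric ((ae_density _).2 ha).
apply/ae_density; apply: filterS2 s1 s2 => q iaq haq.
rewrite -(avg_op_density ma iaq) /avg_op /Rintegral; congr fine.
have mt c : measurable_fun setT c ->
    measurable_fun setT (fun p => (tensor c g (H (q, p)))%:E).
  move=> mc; apply/measurable_EFinP.
  apply: (measurable_fun_pair2 q (f := tensor c g \o H)).
  apply: measurableT_comp H_meas; apply: measurable_funM.
    exact: (measurableT_comp mc measurable_fst).
  exact: (measurableT_comp g_meas measurable_snd).
apply: (ae_eq_integral _ _ measurableT (mt _ mh) (mt _ (measurable_funM ma f_meas))).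
apply: filterS ((ae_probability_density _).1 haq) => p hp _.
by rewrite /tensor; congr (_ * _)%:E.
Qed.

Lemma measurable_iter_avg_op h n : measurable_fun setT h ->
  measurable_fun setT (iter n (avg_op nu g H) h).
Proof.
move=> mh; elim: n => [|n IH]; first exact: mh.
by rewrite iterS; exact: measurable_avg_op.
Qed.

Lemma iter_avg_op_density r h a n : 1 <= r -> measurable_fun setT h -> Lr m r a ->
  {ae mu, forall q, h q = a q * f q} ->
  {ae mu, forall q, iter n (avg_op nu g H) h q = iter n K a q * f q}.
Proof.
move=> r1 mh La ha; elim: n => [|n IH]; first exact: ha.
have Ln := Lr_iter_markov mpos markov_symmetric n r1 La.
have iLn := abs_moment_integrable r1 Ln.1 Ln.2.
exact: avg_op_ae_density (measurable_iter_avg_op n mh) Ln.1 iLn IH.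
Qed.

Lemma measurable_weight r h : measurable_fun setT h ->
  measurable_fun setT (fun q => `|h q| `^ r / f q `^ (r - 1)).
Proof.
move=> mh; apply: measurable_funM; first exact/measurable_EFinP/measurable_norm_powR.
under eq_fun do rewrite -powRN.
exact: (measurableT_comp (measurable_powR _) f_meas).
Qed.

(** Where [f] is positive, [|a * f| `^ r / f `^ (r - 1) = |a| `^ r * f]: this makes
    [h |-> h / f] an isometry onto [L^r(m)]. *)
Lemma weighted_abs_moment r h a : 0 < r -> measurable_fun setT h -> measurable_fun setT a ->
  {ae mu, forall q, h q = a q * f q} ->
  (\int[mu]_q (`|h q| `^ r / f q `^ (r - 1))%:E)%E = abs_moment m r a.
Proof.
move=> r0 mh ma ha; have mar := measurable_norm_powR r ma.
rewrite /abs_moment ge0_integral_density//.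
apply: (ae_eq_integral _ _ measurableT).
- by apply/measurable_EFinP; exact: measurable_weight.
- by apply: emeasurable_funM => //; exact/measurable_EFinP.
apply: filterS2 ha f_support => q -> fq _ /=.
have fr : f q `^ (r - 1) != 0 by rewrite gt_eqF// powR_gt0.
rewrite normrM (ger0_norm (f_ge0 q)) powRM// -EFinM -mulrA.
by rewrite -(mulr_powRB1 (f_ge0 q) r0) mulfK.
Qed.

Lemma wLspace_density r h a : 0 < r -> measurable_fun setT h -> measurable_fun setT a ->
  {ae mu, forall q, h q = a q * f q} -> wLspace mu f r h <-> Lr m r a.
Proof.
move=> r0 mh ma ha; rewrite /wLspace /Lr (weighted_abs_moment r0 mh ma ha).
by split=> -[_ ?]; split.
Qed.

Lemma measurable_quotient h : measurable_fun setT h ->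
  measurable_fun setT (fun q => h q / f q).
Proof.
move=> mh; apply: (measurable_funM mh).
have -> : (fun q => (f q)^-1) = (fun q => f q `^ (-1)).
  by apply/funext => q; rewrite powR_inv1.
exact: (measurableT_comp (measurable_powR _) f_meas).
Qed.

Lemma wpairing_density h k a b : measurable_fun setT h -> measurable_fun setT k ->
  measurable_fun setT a -> measurable_fun setT b ->
  {ae mu, forall q, h q = a q * f q} -> {ae mu, forall q, k q = b q * f q} ->
  wpairing mu f h k = \int[m]_q (a q * b q).
Proof.
move=> mh mk ma mb ha kb; have mab := measurable_funM ma mb.
rewrite (Rintegral_density _ _ _ mab) /wpairing /Rintegral; congr fine.
apply: (ae_eq_integral _ _ measurableT).
- by apply/measurable_EFinP; exact: (measurable_quotient (measurable_funM mh mk)).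
- by apply/measurable_EFinP; exact: (measurable_funM mab f_meas).
apply: filterS3 ha kb f_support => q -> -> fq _ /=.
by congr EFin; field; rewrite gt_eqF.
Qed.

Lemma ae_quotient h : {ae mu, forall q, h q = h q / f q * f q}.
Proof. by apply: filterS f_support => q fq; rewrite divfK// gt_eqF. Qed.

Hypothesis H_covers : {ae mu, forall q, covers mu nu (fun p => (H (q, p)).1)}.

Lemma covers_density : {ae m, forall q, covers m w (fun p => position (q, p))}.
Proof.
apply/ae_density; apply: filterS H_covers => q covq N wN.
apply/(negligible_density f_meas f_ge0 f_int_lty f_support); apply: covq.
apply: (negligible_density g_meas g_ge0 g_int_lty _ N).1 wN.
exact: aeW.
Qed.

(** Both modes of convergence are read off from the convergence of the iterates of
    [K] on [h / f] in [L^r(m)]. *)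
Lemma avg_op_cvg r h : 1 < r -> wLspace mu f r h ->
  let u := fun n : nat => iter n (avg_op nu g H) h in
  let l := fun q : Q => f q * ((\int[mu]_x h x) / (\int[mu]_x f x)) in
  wweak_cvg mu f r u l /\ wstrong_cvg mu f r u l.
Proof.
move=> r1 Lh u l; have mh := Lh.1; have r0 : 0 < r := lt_trans ltr01 r1.
pose a q := h q / f q; have ma : measurable_fun setT a := measurable_quotient mh.
have ha : {ae mu, forall q, h q = a q * f q} := ae_quotient h.
have La : Lr m r a := (wLspace_density r0 mh ma ha).1 Lh.
have m_gt0 : (0 < m setT)%E by [].
pose c := mean m a.
have lE : l = (fun q => cst c q * f q).
  apply/funext => q; rewrite /l mulrC /c /mean (Rintegral_density _ _ _ ma).
  congr (_ / _ * _); rewrite /Rintegral; congr fine.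
  apply: (ae_eq_integral _ _ measurableT); first exact/measurable_EFinP.
    by apply/measurable_EFinP; exact: measurable_funM.
  by apply: filterS ha => x -> _.
have mu_ n : measurable_fun setT (u n) := measurable_iter_avg_op n mh.
have mK n : measurable_fun setT (iter n K a) := measurable_iter_markov w mpos n ma.
have LK n : Lr m r (iter n K a) := Lr_iter_markov mpos markov_symmetric n (ltW r1) La.
have uE n : {ae mu, forall q, u n q = iter n K a q * f q} :=
  iter_avg_op_density n (ltW r1) mh La ha.
have mc : measurable_fun setT (cst c : Q -> R) by [].
have ml : measurable_fun setT l by rewrite lE; exact: measurable_funM.
have lE' : {ae mu, forall q, l q = cst c q * f q} by apply: aeW => q; rewrite lE.
have Lc : Lr m r (cst c) := Lr_cst m c (ltW r0).
have cvg_m := iter_markov_cvg mpos markov_symmetric covers_density m_gt0 (ltW r1) La.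
have wu n : wLspace mu f r (u n) := (wLspace_density r0 (mu_ n) (mK n) (uE n)).2 (LK n).
have wl : wLspace mu f r l := (wLspace_density r0 ml mc lE').2 Lc.
split; split => //.
  move=> s b sr Lb; have mb := Lb.1.
  have rB1 : r - 1 != 0 by rewrite subr_eq0 gt_eqF.
  have s1 : s = r / (r - 1).
    by apply: (canRL (mulfK rB1)); rewrite mulrBr mulr1 -sr (addrC s) addrK.
  have s0 : 0 < s by rewrite s1 divr_gt0// subr_gt0.
  have rs : r^-1 + s^-1 = 1 by rewrite s1; field; rewrite rB1 gt_eqF.
  pose b' q := b q / f q; have mb' : measurable_fun setT b' := measurable_quotient mb.
  have bE : {ae mu, forall q, b q = b' q * f q} := ae_quotient b.
  have Lb' : Lr m s b' := (wLspace_density s0 mb mb' bE).1 Lb.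
  rewrite (wpairing_density ml mb mc mb' lE' bE).
  under eq_fun do rewrite (wpairing_density (mu_ _) mb (mK _) mb' (uE _) bE).
  by apply: (pairing_cvg r0 s0 rs mK mc mb' (fun n => (LK n).2) Lc.2 Lb'.2 cvg_m).
have wE n : wnorm mu f r (fun q => u n q - l q) =
    (abs_moment m r (fun q => iter n K a q - c)%R `^ r^-1)%E.
  rewrite /wnorm; congr poweR; apply: (weighted_abs_moment r0).
  - exact: measurable_funB.
  - exact: measurable_funB.
  - by apply: filterS (uE n) => q ->; rewrite lE mulrBl.
apply/cvge0P => [n|e e0]; first exact: poweR_ge0.
have er0 : 0 < e `^ r by rewrite powR_gt0.
have /cvge0P - /(_ (fun n => abs_moment_ge0 _ _ _) _ er0) := cvg_m.
apply: filterS => n ne; rewrite wE.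
have -> : e = (e `^ r) `^ r^-1 by rewrite -powRrM mulfV ?gt_eqF// powRr1// ltW.
rewrite -poweR_EFin; apply: gt0_ler_poweR.
- by rewrite invr_ge0 ltW.
- by rewrite in_itv/= leey abs_moment_ge0.
- by rewrite in_itv/= leey lee_fin ltW.
- exact: ne.
Qed.

End HamiltonianTransfer.

Theorem theorem1 (R : realType) (dQ dP : measure_display)
    (Q : measurableType dQ) (P : measurableType dP)
    (mu : {sigma_finite_measure set Q -> \bar R})
    (nu : {sigma_finite_measure set P -> \bar R})
    (f : Q -> R) (g : P -> R) (H Hinv : Q * P -> Q * P)
    (f_meas : measurable_fun setT f)
    (f_ge0 : forall q, 0 <= f q)
    (f_int_gt0 : (0 < \int[mu]_q (f q)%:E)%E)
    (f_int_lty : (\int[mu]_q (f q)%:E < +oo)%E)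
    (g_meas : measurable_fun setT g)
    (g_gt0 : forall p, 0 < g p)
    (g_int1 : (\int[nu]_p (g p)%:E = 1)%E)
    (H_meas : measurable_fun setT H)
    (Hinv_meas : measurable_fun setT Hinv)
    (HK : cancel H Hinv) (HinvK : cancel Hinv H)
    (H_density : tensor f g \o H = tensor f g)
    (H_measure : forall A : Q * P -> R,
       (mu \x nu)%E.-integrable setT (EFin \o A) ->
       (\int[(mu \x nu)%E]_z (A (H z))%:E = \int[(mu \x nu)%E]_z (A z)%:E)%E)
    (H_covers : {ae mu, forall q, covers mu nu (fun p => (H (q, p)).1)})
    (f_support : {ae mu, forall q, 0 < f q})
    (T_selfadjoint : forall h : Q -> R, mu.-integrable setT (EFin \o h) ->
       {ae mu, forall q, avg_op nu g Hinv h q = avg_op nu g H h q})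
    (r : R) (r_gt1 : 1 < r) (h : Q -> R) (h_Lr : wLspace mu f r h) :
  let u := fun n : nat => iter n (avg_op nu g H) h in
  let l := fun q : Q => f q * ((\int[mu]_x h x) / (\int[mu]_x f x)) in
  wweak_cvg mu f r u l /\ (2 <= r -> wstrong_cvg mu f r u l).
Proof.
have g_ge0 p : 0 <= g p by exact: ltW.
have g_int_lty : (\int[nu]_p (g p)%:E < +oo)%E by rewrite g_int1 ltry.
have [] := avg_op_cvg f_meas f_ge0 f_int_gt0 f_int_lty g_meas g_ge0 g_gt0
  g_int_lty g_int1 H_meas Hinv_meas HK HinvK H_density H_measure f_support
  T_selfadjoint H_covers r_gt1 h_Lr.
by split.
Qed.
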